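(* Let $\mathcal{A}$ be a $W^{*}$-algebra and let $F \in B^{a}(H_{\mathcal{A}})$. Then $F \in \mathcal{M}\Phi_{-}(H_{\mathcal{A}})$ if and only if $(\operatorname{Im}(F-K))^{\perp}$ is finitely generated for all $K \in K^{*}(H_{\mathcal{A}})$.
   Context: $H_{\mathcal{A}}=l_{2}(\mathcal{A})$ is the standard (right) Hilbert $C^{*}$-module over $\mathcal{A}$ of sequences $(a_i)_{i\in\mathbb{N}}$ in $\mathcal{A}$ with $\sum_i a_i^{*}a_i$ norm-convergent. $B^{a}(H_{\mathcal{A}})$ is the set of bounded adjointable $\mathcal{A}$-linear operators on $H_{\mathcal{A}}$. $K^{*}(H_{\mathcal{A}})\subseteq B^{a}(H_{\mathcal{A}})$ is the set of adjointable compact operators, i.e. the norm closure of the linear span of the operators $z\mapsto x\langle y,z\rangle$, $x,y\in H_{\mathcal{A}}$. A Hilbert module is finitely generated if it is the linear span (over $\mathbb{C}$ and $\mathcal{A}$) of a finite subset. $\tilde\oplus$ denotes the direct sum of closed submodules, not necessarily orthogonal. $\mathcal{M}\Phi_{-}(H_{\mathcal{A}})$ (lower semi-$\mathcal{A}$-Fredholm operators) is the set of $F\in B^{a}(H_{\mathcal{A}})$ for which there are closed submodules $M_1,N_1,M_2,N_2$ with $H_{\mathcal{A}}=M_1\tilde\oplus N_1=M_2\tilde\oplus N_2$ such that $F(M_1)\subseteq M_2$, $F(N_1)\subseteq N_2$, $F|_{M_1}:M_1\to M_2$ is an isomorphism (bounded $\mathcal{A}$-linear bijection), and $N_2$ is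 finitely generated. *)

(* Defs.v *)
From HB Require Import structures.
From mathcomp Require Import all_boot all_order all_algebra.
From mathcomp Require Import complex.
From mathcomp Require Import all_classical all_reals all_analysis.

Set Implicit Arguments.
Unset Strict Implicit.
Unset Printing Implicit Defensive.

Import Order.TTheory GRing.Theory Num.Theory.
Import numFieldNormedType.Exports.

Local Open Scope classical_set_scope.
Local Open Scope ring_scope.
Local Open Scope complex_scope.

(* The norm of a normed module over R[i] takes its (real, nonnegative) values
    in R[i]; comparisons x <= y in R[i] entail that y - x is real. *)

(* HB cannot declare a common extension of the ring and the normed module
   structures (numDomainType already extends both), so the product is a field
   of the mixin, from which the ring structure is derived. *)
HB.mixin Record CompleteNormedModule_isCStar (R : realType) A
    of CompleteNormedModule R[i] A := {
  cstar_mul : A -> A -> A ;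
  cstar_one : A ;
  cstar_mulA : associative cstar_mul ;
  cstar_mul1l : left_id cstar_one cstar_mul ;
  cstar_mul1r : right_id cstar_one cstar_mul ;
  cstar_mulDl : left_distributive cstar_mul +%R ;
  cstar_mulDr : right_distributive cstar_mul +%R ;
  cstar_scaleAl : forall (c : R[i]) (a b : A),
    c *: cstar_mul a b = cstar_mul (c *: a) b ;
  cstar_scaleAr : forall (c : R[i]) (a b : A),
    c *: cstar_mul a b = cstar_mul a (c *: b) ;
  star : A -> A ;
  starK : involutive star ;
  starD : {morph star : a b / a + b} ;
  starZ : forall (c : R[i]) (a : A), star (c *: a) = c^* *: star a ;
  starM : forall a b : A, star (cstar_mul a b) = cstar_mul (star b) (star a) ;
  cstar_normM : forall a b : A, `|cstar_mul a b| <= `|a| * `|b| ;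
  cstar_identity : forall a : A, `|cstar_mul (star a) a| = `|a| ^+ 2
}.

#[short(type="cstarAlgType")]
HB.structure Definition CStarAlgebra (R : realType) :=
  {A of CompleteNormedModule_isCStar R A & CompleteNormedModule R[i] A}.

Section CStarRing.
Context (R : realType) (A : cstarAlgType R).

Let mul0l : left_zero (0 : A) (@cstar_mul R A).
Proof.
by move=> a; apply: (addIr (cstar_mul 0 a)); rewrite -cstar_mulDl !add0r.
Qed.

Let mul0r : right_zero (0 : A) (@cstar_mul R A).
Proof.
by move=> a; apply: (addIr (cstar_mul a 0)); rewrite -cstar_mulDr !add0r.
Qed.

HB.instance Definition _ := GRing.Nmodule_isPzSemiRing.Build (A : Type)
  (@cstar_mulA R A) (@cstar_mul1l R A) (@cstar_mul1r R A)
  (@cstar_mulDl R A) (@cstar_mulDr R A) mul0l mul0r.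

End CStarRing.

(* [ip] makes the Banach space [H] a Hilbert space (antilinear in the first
   variable). *)
Definition hilbert_product (R : realType) (H : completeNormedModType R[i])
    (ip : H -> H -> R[i]) : Prop :=
  [/\ forall (c : R[i]) (x y z : H), ip x (c *: y + z) = c * ip x y + ip x z,
      forall x y : H, ip y x = (ip x y)^*
    & forall x : H, ip x x = `|x| ^+ 2].

(* [pi] is a unital *-representation of [A] on [H]; the last clause says that
   the operator norm of [pi a] is [`|a|]. *)
Definition isometric_representation (R : realType) (A : cstarAlgType R)
    (H : completeNormedModType R[i]) (ip : H -> H -> R[i])
    (pi : A -> {linear H -> H}) : Prop :=
  [/\ forall (c : R[i]) (a b : A) (h : H),
        pi (c *: a + b) h = c *: pi a h + pi b h,
      forall (a b : A) (h : H), pi (a * b) h = pi a (pi b h),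
      forall h : H, pi 1 h = h,
      forall (a : A) (h k : H), ip (pi a h) k = ip h (pi (star a) k)
    & forall (a : A) (r : R[i]), 0 <= r ->
        (`|a| <= r <-> forall h : H, `|pi a h| <= r * `|h|)].

Definition commute_op (T : Type) (f g : T -> T) : Prop := f \o g =1 g \o f.

(* The set [B] of operators contains its bicommutant in the bounded operators
   (the other inclusion always holds). *)
Definition bicommutant_closed (R : realType) (H : completeNormedModType R[i])
    (B : set (H -> H)) : Prop :=
  forall T : {linear H -> H}, continuous T ->
    (forall S : {linear H -> H}, continuous S ->
       (forall P, B P -> commute_op S P) -> commute_op S T) ->
    B T.

(* A W*-algebra is a C*-algebra isomorphic to a von Neumann algebra, i.e. to a
   unital *-subalgebra of bounded operators equal to its bicommutant. *)
Definition is_wstar (R : realType) (A : cstarAlgType R) : Prop :=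
  exists (H : completeNormedModType R[i]) (ip : H -> H -> R[i])
         (pi : A -> {linear H -> H}),
    [/\ hilbert_product ip,
        isometric_representation ip pi
      & bicommutant_closed [set (pi a : H -> H) | a in setT]].

(* Vectors of l_2(A) are the sequences in the set [l2 A]; an operator on
    l_2(A) is represented by a function on all sequences, of which only the
    values on [l2 A] matter: every notion below depends only on them. *)

Section StandardModule.
Context (R : realType) (A : cstarAlgType R).
Implicit Types (x y z : nat -> A) (F K T : (nat -> A) -> (nat -> A)).
Implicit Types (M N S : set (nat -> A)).

Definition l2 : set (nat -> A) :=
  [set x | cvgn (series (fun i => star (x i) * x i))].

Definition l2ip x y : A := limn (series (fun i => star (x i) * y i)).

Definition l2norm x : R[i] := sqrtC `|l2ip x x|.

Definition ract x (a : A) : nat -> A := fun i => x i * a.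

Definition closed_submodule M : Prop :=
  [/\ M `<=` l2,
      M 0,
      (forall (c : R[i]) x y, M x -> M y -> M (c *: x + y)),
      (forall x (a : A), M x -> M (ract x a))
    & (forall x, l2 x ->
         (forall e : R[i], 0 < e -> exists2 y, M y & l2norm (x - y) < e) ->
         M x)].

Definition finitely_generated M : Prop :=
  exists (n : nat) (g : 'I_n -> nat -> A),
    (forall j, M (g j)) /\
    M = [set x | exists (c : 'I_n -> R[i]) (a : 'I_n -> A),
                   x = \sum_(j < n) (c j *: g j + ract (g j) (a j))].

Definition direct_sum M N : Prop :=
  [/\ closed_submodule M, closed_submodule N,
      M `&` N = [set 0]
    & l2 = [set x + y | x in M & y in N]].

Definition bounded_Alinear M N F : Prop :=
  [/\ forall x, M x -> N (F x),
      (forall (c : R[i]) x y, M x -> M y -> F (c *: x + y) = c *: F x + F y),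
      (forall x (a : A), M x -> F (ract x a) = ract (F x) a)
    & exists r : R[i], forall x, M x -> l2norm (F x) <= r * l2norm x].

Definition isomorphism M N F : Prop :=
  bounded_Alinear M N F /\ set_bij M N F.

Definition adjointable F : Prop :=
  bounded_Alinear l2 l2 F /\
  exists G, bounded_Alinear l2 l2 G /\
    forall x y, l2 x -> l2 y -> l2ip (F x) y = l2ip x (G y).

Definition rank_one x y : (nat -> A) -> (nat -> A) :=
  fun z => ract x (l2ip y z).

Definition finite_rank T : Prop :=
  exists (n : nat) (c : 'I_n -> R[i]) (u v : 'I_n -> nat -> A),
    (forall j, l2 (u j) /\ l2 (v j)) /\
    forall z, l2 z -> T z = \sum_(j < n) c j *: rank_one (u j) (v j) z.

Definition adjointable_compact K : Prop :=
  adjointable K /\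
  forall e : R[i], 0 < e ->
    exists2 T, finite_rank T &
      forall x, l2 x -> l2norm (K x - T x) <= e * l2norm x.

Definition orthogonal_complement S : set (nat -> A) :=
  [set y | l2 y /\ forall x, S x -> l2ip x y = 0].

Definition lower_semi_Fredholm F : Prop :=
  adjointable F /\
  exists M1 N1 M2 N2,
    [/\ direct_sum M1 N1 /\ direct_sum M2 N2,
        F @` M1 `<=` M2,
        F @` N1 `<=` N2,
        isomorphism M1 M2 F
      & finitely_generated N2].

End StandardModule.

Arguments l2 {R} A.

(* Main.v *)
Require Import Defs.
From HB Require Import structures.
From mathcomp Require Import all_boot all_order all_algebra.
From mathcomp Require Import complex.
From mathcomp Require Import all_classical all_reals all_analysis.
From mathcomp Require Import ring lra.

Set Implicit Arguments.
Unset Strict Implicit.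
Unset Printing Implicit Defensive.

Import Order.TTheory GRing.Theory Num.Theory.
Import numFieldNormedType.Exports.

Local Open Scope classical_set_scope.
Local Open Scope ring_scope.
Local Open Scope complex_scope.

(** Let G be the adjoint of F, let L be the adjoint of a compact K, and call a
    sequence a tail at n when its first n coordinates vanish.  Since the
    complement of Im(F - K) is Ker(G - L), the theorem compares F with the
    kernels of the perturbations of G.  The link is the condition that G be
    bounded below on the tails at some n ([bounded_below_tail]); it turns out
    to be equivalent to both sides.

    If F is lower semi-Fredholm, the module is F(H) + N with N generated by
    g_1, ..., g_k.  A gliding hump ([uniform_lower_bound]) turns this
    surjectivity into the estimate c |y| <= |G y| + sum |<y, g_j>|, and far
    enough out the g_j have small tails, so G is bounded below on tails
    ([Fredholm_bounded_below]).  A compact operator has small range in the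
    tails, so the bound survives the perturbation
    ([bounded_below_tail_compact]).

    Suppose now that G is bounded below on the tails at n, with projection P.
    The positive operator P F G P is bounded below, hence onto the tails: its
    translates by large t are onto, and t can be lowered to 0 by steps of a
    fixed size ([positive_onto]).  Two things follow.  First, P F has a bounded
    right inverse, whose idempotents give a Fredholm decomposition of F
    ([bounded_below_Fredholm]).  Secondly, an element of Ker G is determined by
    its first n coordinates, so that Ker G is an image of the module of
    relations among n vectors.  Over a W*-algebra that module is the range of a
    projection matrix, because the kernel projection of the Gram matrix is a
    strong limit of polynomials in it, and its entries belong to the bicommutant
    ([syzygy_finitely_generated], [kernel_finitely_generated]).

    Suppose finally that G is bounded below on no tail.  Then there are unit
    vectors v_k with consecutive finite supports and |G v_k| <= 2^-k.  The
    positive element <v_k, v_k> need not be invertible, but it has a spectral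
    cutoff: elements c_k and h_k != 0 of A with c_k <v_k, v_k> h_k = h_k and c_k
    bounded by 2 ([cutoff_rep]).  Therefore L = sum_k G(v_k c_k) <v_k, .> is the
    adjoint of a compact operator and agrees with G on every v_k h_k
    ([compact_infinite_kernel]).  So Ker(G - L) contains nonzero tails at every
    n, which a finitely generated closed submodule does not
    ([finitely_generated_tail]). *)

(** * Real-valued norms *)

Section RealNorm.
Context (R : realType).

(** The norms at hand take their values in R[i]; taking real parts puts the
    estimates in the ordered field R, where square roots and linear arithmetic
    apply. *)
Definition rn (V : normedZmodType R[i]) (v : V) : R := complex.Re `|v|.

Lemma rnE (V : normedZmodType R[i]) (v : V) : (rn v)%:C = `|v|.
Proof. by rewrite /rn RRe_real ?normr_real. Qed.

Lemma rn_le (V W : normedZmodType R[i]) (v : V) (w : W) :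
  (`|v| <= `|w|) = (rn v <= rn w).
Proof. by rewrite -!rnE lecR. Qed.

Lemma rn_ge0 (V : normedZmodType R[i]) (v : V) : 0 <= rn v.
Proof. by rewrite -ler0c rnE. Qed.

Lemma rn0 (V : normedZmodType R[i]) : rn (0 : V) = 0.
Proof. by rewrite /rn normr0. Qed.

Lemma rn_eq0 (V : normedZmodType R[i]) (v : V) : rn v = 0 -> v = 0.
Proof. by move=> v0; apply/eqP; rewrite -normr_eq0 -rnE v0. Qed.

Lemma rnD (V : normedZmodType R[i]) (u v : V) : rn (u + v) <= rn u + rn v.
Proof. by rewrite -lecR rmorphD /= !rnE ler_normD. Qed.

Lemma rnN (V : normedZmodType R[i]) (v : V) : rn (- v) = rn v.
Proof. by rewrite /rn normrN. Qed.

Lemma rnB (V : normedZmodType R[i]) (u v : V) : rn (u - v) <= rn u + rn v.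
Proof. by rewrite -(rnN v) rnD. Qed.

Lemma rnBC (V : normedZmodType R[i]) (u v : V) : rn (u - v) = rn (v - u).
Proof. by rewrite -rnN opprB. Qed.

Lemma rnZ (V : normedModType R[i]) (c : R[i]) (v : V) : rn (c *: v) = rn c * rn v.
Proof. by apply: complexI; rewrite rmorphM /= !rnE normrZ. Qed.

Lemma rnC (c : R) : rn (c%:C : R[i]) = `|c|.
Proof. by rewrite /rn normc_def /= expr0n /= addr0 sqrtr_sqr. Qed.

Lemma rn_conj (c : R[i]) : rn (c^*%C) = rn c.
Proof. by rewrite /rn normcJ. Qed.

Lemma rnMc (c d : R[i]) : rn (c * d) = rn c * rn d.
Proof. by apply: complexI; rewrite rmorphM /= !rnE normrM. Qed.

Lemma rn_sum (V : normedZmodType R[i]) I (r : seq I) (P : pred I) (f : I -> V) :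
  rn (\sum_(i <- r | P i) f i) <= \sum_(i <- r | P i) rn (f i).
Proof.
elim/big_ind2: _ => [||//]; first by rewrite rn0.
by move=> u a v b ua vb; apply: (le_trans (rnD _ _)); apply: lerD.
Qed.

Lemma rn_sqc (c : R[i]) : c * c^*%C = (rn c ^+ 2)%:C.
Proof. by rewrite -sqr_normc -rnE rmorphXn. Qed.

Lemma conjcM (c d : R[i]) : (c * d)^*%C = c^*%C * d^*%C.
Proof. exact: rmorphM. Qed.

Lemma conjcD (c d : R[i]) : (c + d)^*%C = c^*%C + d^*%C.
Proof. exact: rmorphD. Qed.

Lemma conjcN (c : R[i]) : (- c)^*%C = - c^*%C.
Proof. exact: raddfN. Qed.

Lemma conjc_sum I (r : seq I) (P : pred I) (f : I -> R[i]) :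
  (\sum_(i <- r | P i) f i)^*%C = \sum_(i <- r | P i) (f i)^*%C.
Proof. exact: (big_morph _ conjcD (conjc0 R)). Qed.

End RealNorm.

(** * Positive sesquilinear forms *)

Section CauchySchwarz.
Context (R : realType) (V : lmodType R[i]) (B : V -> V -> R[i]).

Definition psd_form : Prop :=
  [/\ forall (c : R[i]) (x y z : V), B x (c *: y + z) = c * B x y + B x z,
      forall x y : V, B y x = (B x y)^*
    & forall x : V, 0 <= B x x].

Lemma cauchy_schwarz (u v : V) : psd_form ->
  rn (B u v) ^+ 2 <= complex.Re (B u u) * complex.Re (B v v).
Proof.
move=> [Blin Bsym Bge0].
set b := B u v; set a := complex.Re (B u u); set c := complex.Re (B v v).
have Ba : B u u = a%:C by rewrite /a RRe_real ?ger0_real.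
have Bc : B v v = c%:C by rewrite /c RRe_real ?ger0_real.
have a0 : 0 <= a by rewrite -ler0c -Ba.
have c0 : 0 <= c by rewrite -ler0c -Bc.
(* The form evaluated at u + t conj(b) v, as a real quadratic polynomial in t. *)
have key (t : R) : 0 <= a + 2 * t * rn b ^+ 2 + t ^+ 2 * rn b ^+ 2 * c.
  set d : R[i] := t%:C * b^*%C; have := Bge0 (d *: v + u).
  rewrite Blin (Bsym v) (Bsym u) !Blin Ba Bc (Bsym u v) -/b.
  rewrite !(conjcM, conjcD) !conjcK.
  rewrite !conjc_real /d.
  have -> : t%:C * b^*%C * (t%:C * b * c%:C + b) + (t%:C * b * b^*%C + a%:C)
    = (a + 2 * t * rn b ^+ 2 + t ^+ 2 * rn b ^+ 2 * c)%:C.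
    have := rn_sqc b; move: (rn b ^+ 2) => r br.
    rewrite !rmorphD !rmorphM /= -br.
    have -> : 2%:C = 2 :> R[i] by rewrite -[2 in LHS]/(1 + 1) rmorphD.
    by ring.
  by rewrite ler0c.
have [c_gt0|] := ltP 0 c.
  have := key (- c^-1).
  have -> : a + 2 * - c^-1 * rn b ^+ 2 + (- c^-1) ^+ 2 * rn b ^+ 2 * c
    = (a * c - rn b ^+ 2) / c by field; rewrite gt_eqF.
  by rewrite pmulr_lge0 ?invr_gt0// subr_ge0.
move=> c_le0; have {c_le0 c0} c0 : c = 0 by apply/eqP; rewrite eq_le c_le0.
have [b0|b0] := eqVneq (rn b) 0; first by rewrite b0 expr0n c0 mulr0.
(* When B v v = 0 the polynomial is affine with slope 2 |b|^2, so it is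
   negative at this point unless b = 0. *)
have := key (- (a + 1) / (rn b ^+ 2) / 2); rewrite c0 mulr0 addr0.
have -> : a + 2 * (- (a + 1) / rn b ^+ 2 / 2) * rn b ^+ 2 = -1 by field.
by rewrite lerNr oppr0 ler10.
Qed.

Context (HB : psd_form).

Lemma psdC x y : B y x = (B x y)^*%C.
Proof. by case: HB. Qed.
Lemma psdDr x y z : B x (y + z) = B x y + B x z.
Proof. by case: HB => h _ _; rewrite -[y]scale1r h mul1r scale1r. Qed.
Lemma psd0r x : B x 0 = 0.
Proof. by apply: (addrI (B x 0)); rewrite -psdDr !addr0. Qed.
Lemma psdZr c x y : B x (c *: y) = c * B x y.
Proof. by case: HB => h _ _; rewrite -[c *: y]addr0 h psd0r addr0. Qed.
Lemma psdNr x y : B x (- y) = - B x y.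
Proof. by rewrite -scaleN1r psdZr mulN1r. Qed.
Lemma psdBr x y z : B x (y - z) = B x y - B x z.
Proof. by rewrite psdDr psdNr. Qed.
Lemma psdDl x y z : B (x + y) z = B x z + B y z.
Proof. by rewrite psdC psdDr conjcD -!psdC. Qed.
Lemma psdZl c x y : B (c *: x) y = c^*%C * B x y.
Proof. by rewrite psdC psdZr conjcM -psdC. Qed.
Lemma psd0l x : B 0 x = 0.
Proof. by rewrite psdC psd0r conjc0. Qed.
Lemma psdNl x y : B (- x) y = - B x y.
Proof. by rewrite psdC psdNr conjcN -psdC. Qed.
Lemma psdBl x y z : B (x - y) z = B x z - B y z.
Proof. by rewrite psdDl psdNl. Qed.
Lemma psd_sumr I (r : seq I) (P : pred I) (f : I -> V) x :
  B x (\sum_(i <- r | P i) f i) = \sum_(i <- r | P i) B x (f i).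
Proof. exact: (big_morph _ (psdDr x) (psd0r x)). Qed.
Lemma psd_suml I (r : seq I) (P : pred I) (f : I -> V) x :
  B (\sum_(i <- r | P i) f i) x = \sum_(i <- r | P i) B (f i) x.
Proof. exact: (big_morph (B^~ x) (fun a b => psdDl a b x) (psd0l x)). Qed.
Lemma psd_real x : B x x = (complex.Re (B x x))%:C.
Proof. by case: HB => _ _ h; rewrite RRe_real ?ger0_real. Qed.
Lemma psd_Re_ge0 x : 0 <= complex.Re (B x x).
Proof. by case: HB => _ _ h; rewrite -ler0c -psd_real. Qed.

End CauchySchwarz.

(** * Limits in normed modules *)

Section Limits.
Context (R : realType).

Definition tends (V : normedModType R[i]) (u : nat -> V) (l : V) : Prop :=
  forall e : R, 0 < e -> exists N, forall n, (N <= n)%N -> rn (u n - l) <= e.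

Lemma tendsP (V : normedModType R[i]) (u : nat -> V) (l : V) :
  tends u l <-> u @ \oo --> l.
Proof.
split=> [ul|].
  apply/cvgrPdist_le => e e0.
  have eE : e = (complex.Re e)%:C by rewrite RRe_real ?gtr0_real.
  have e0' : 0 < complex.Re e by rewrite -ltcR -eE.
  have [N HN] := ul _ e0'.
  exists N => // n /= Nn.
  by rewrite eE -rnE lecR rnBC HN.
move/cvgrPdist_le => ul e e0.
have e0' : 0 < e%:C by rewrite ltcR.
have [N _ HN] := ul _ e0'.
exists N => n Nn; rewrite rnBC -lecR rnE.
exact: HN.
Qed.

Lemma tends_lim (V : normedModType R[i]) (u : nat -> V) (l : V) :
  tends u l -> limn u = l.
Proof. by move/tendsP/cvg_lim; apply. Qed.

Lemma tends_cvg (V : normedModType R[i]) (u : nat -> V) (l : V) :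
  tends u l -> cvgn u.
Proof. by move/tendsP/cvgP. Qed.

Lemma cvg_tends (V : normedModType R[i]) (u : nat -> V) :
  cvgn u -> tends u (limn u).
Proof. by move=> ?; apply/tendsP. Qed.

Definition cauchyR (V : normedModType R[i]) (u : nat -> V) : Prop :=
  forall e : R, 0 < e ->
  exists N, forall m n, (N <= m <= n)%N -> rn (u n - u m) <= e.

Lemma cauchy_tends (V : completeNormedModType R[i]) (u : nat -> V) :
  cauchyR u -> exists l, tends u l.
Proof.
move=> cu; exists (limn u); apply/tendsP/cauchy_cvgP/cauchy_exP => e e0.
have eE : e = (complex.Re e)%:C by rewrite RRe_real ?gtr0_real.
have e0' : 0 < complex.Re e / 2 by rewrite divr_gt0 // -ltcR -eE.
have [N HN] := cu _ e0'.
exists (u N); exists N => // n /= Nn.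
rewrite -ball_normE /= eE -rnE ltcR rnBC.
by rewrite (le_lt_trans (HN N n _)) ?leqnn// ltr_pdivrMr// ltr_pMr ?ltr1n//; lra.
Qed.

Lemma tends_cauchy (V : normedModType R[i]) (u : nat -> V) (l : V) :
  tends u l -> cauchyR u.
Proof.
move=> ul e e0; have [|N HN] := ul (e / 2); first by rewrite divr_gt0.
exists N => m n /andP[Nm mn].
have := HN _ Nm; have := HN _ (leq_trans Nm mn); have := rnB (u n - l) (u m - l).
by rewrite opprB addrA subrK; lra.
Qed.

Lemma tends_cst (V : normedModType R[i]) (l : V) : tends (fun=> l) l.
Proof. by move=> e e0; exists 0%N => n _; rewrite subrr rn0 ltW. Qed.

Lemma tends_unique (V : normedModType R[i]) (u : nat -> V) (l l' : V) :
  tends u l -> tends u l' -> l = l'.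
Proof. by move=> /tends_lim <- /tends_lim. Qed.

Lemma tends_eq (V : normedModType R[i]) (u v : nat -> V) (l : V) :
  u =1 v -> tends u l -> tends v l.
Proof. by move=> uv ul e /ul[N HN]; exists N => n Nn; rewrite -uv HN. Qed.

Lemma tendsD (V : normedModType R[i]) (u v : nat -> V) (l k : V) :
  tends u l -> tends v k -> tends (fun n => u n + v n) (l + k).
Proof. by move=> /tendsP ul /tendsP vk; apply/tendsP; exact: cvgD. Qed.

Lemma tendsN (V : normedModType R[i]) (u : nat -> V) (l : V) :
  tends u l -> tends (fun n => - u n) (- l).
Proof. by move=> ul e /ul[N HN]; exists N => n /HN; rewrite -opprD rnN. Qed.

Lemma tendsB (V : normedModType R[i]) (u v : nat -> V) (l k : V) :
  tends u l -> tends v k -> tends (fun n => u n - v n) (l - k).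
Proof. by move=> ul /tendsN; exact: tendsD. Qed.

Lemma tends_sum (V : normedModType R[i]) I (r : seq I) (u : I -> nat -> V) (l : I -> V) :
  (forall i, tends (u i) (l i)) ->
  tends (fun n => \sum_(i <- r) u i n) (\sum_(i <- r) l i).
Proof.
move=> ul; elim: r => [|i r IH].
  by rewrite big_nil; apply: (tends_eq _ (tends_cst 0)) => n; rewrite big_nil.
rewrite big_cons; apply: (tends_eq _ (tendsD (ul i) IH)) => n.
by rewrite big_cons.
Qed.

Lemma tends_map (V W : normedModType R[i]) (f : V -> W) (C : R) u l :
  {morph f : x y / x - y} -> (forall v, rn (f v) <= C * rn v) ->
  tends u l -> tends (f \o u) (f l).
Proof.
move=> fB fC ul e e0.
have C0 : 0 < `|C| + 1 by rewrite ltr_wpDl.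
have [|N HN] := ul (e / (`|C| + 1)); first by rewrite divr_gt0.
exists N => n Nn; rewrite /= -fB; apply: (le_trans (fC _)).
have := HN n Nn; rewrite ler_pdivlMr// => h.
apply: le_trans h; rewrite mulrC ler_wpM2l ?rn_ge0//.
by rewrite (le_trans (ler_norm _))// lerDl.
Qed.

Lemma tends_comp (V : normedModType R[i]) (u : nat -> V) l (f : nat -> nat) :
  (forall n, (n <= f n)%N) -> tends u l -> tends (u \o f) l.
Proof.
move=> hf ul e /ul[N HN]; exists N => n Nn; apply: HN.
exact: leq_trans Nn (hf n).
Qed.

Lemma tends_le (V : normedModType R[i]) (u : nat -> V) l (b : R) :
  (forall n, rn (u n) <= b) -> tends u l -> rn l <= b.
Proof.
move=> ub ul; apply/ler_addgt0Pr => e /ul[N /(_ N (leqnn N)) h].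
have := rnB (u N) (u N - l); rewrite opprB addrC subrK => h2.
by have := ub N; lra.
Qed.

Lemma tends_ge (V : normedModType R[i]) (u : nat -> V) l (b : R) N :
  (forall n, (N <= n)%N -> b <= rn (u n)) -> tends u l -> b <= rn l.
Proof.
move=> ub ul; apply/ler_addgt0Pr => e /ul[M /(_ (maxn M N) (leq_maxl _ _)) h].
have := rnD l (u (maxn M N) - l); rewrite addrC subrK.
by have := ub (maxn M N) (leq_maxr _ _); lra.
Qed.

Lemma tends_rn (V : normedModType R[i]) (u : nat -> V) l (e : R) :
  0 < e -> tends u l -> exists N, forall n, (N <= n)%N -> rn l <= rn (u n) + e
    /\ rn (u n) <= rn l + e.
Proof.
move=> e0 /(_ e e0)[N HN]; exists N => n /HN h.
have := rnD l (u n - l); rewrite addrCA subrr addr0.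
have := rnD (u n) (l - u n); rewrite addrCA subrr addr0 (rnBC l).
by move=> *; split; lra.
Qed.

(** The cone of nonnegative complex numbers is closed: r >= 0 means r = |r|,
    and both sides are continuous. *)
Lemma tends_geC (u : nat -> R[i]^o) (l b : R[i]) N :
  (forall n, (N <= n)%N -> b <= u n) -> tends u (l : R[i]^o) -> b <= l.
Proof.
move=> bu ul; rewrite -subr_ge0; set r := l - b.
suff -> : r = (rn r)%:C by rewrite ler0c rn_ge0.
apply/subr0_eq/rn_eq0/eqP; rewrite eq_le rn_ge0 andbT.
apply/ler_addgt0Pr => e e0; have e2 : 0 < e / 2 by rewrite divr_gt0.
have [M HM] := ul _ e2; pose n := maxn M N.
have := HM n (leq_maxl _ _); set d : R[i] := u n - b.
have dE : d = (rn d)%:C by rewrite rnE ger0_norm// subr_ge0 bu// leq_maxr.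
have -> : rn (u n - l) = rn (d - r) by rewrite /d /r opprB addrA subrK.
move=> h; have h1 : `|rn d - rn r| <= rn (d - r).
  have h1 := rnD r (d - r); have h2 := rnD d (r - d).
  rewrite addrCA subrr addr0 in h1; rewrite addrCA subrr addr0 (rnBC r) in h2.
  by rewrite ler_norml; lra.
have -> : r - (rn r)%:C = (r - d) + (rn d - rn r)%:C.
  by rewrite rmorphB /= -dE addrA subrK.
rewrite (le_trans (rnD _ _))// rnC (rnBC r); lra.
Qed.

End Limits.

(** * Involution and norm of a C*-algebra *)

Section Algebra.
Context (R : realType) (A : cstarAlgType R).
Implicit Types a b : A.

Lemma scA_l (c : R[i]) a b : c *: (a * b) = (c *: a) * b.
Proof. exact: cstar_scaleAl. Qed.
Lemma scA_r (c : R[i]) a b : c *: (a * b) = a * (c *: b).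
Proof. exact: cstar_scaleAr. Qed.
Lemma star_mul a b : star (a * b) = star b * star a.
Proof. exact: starM. Qed.
Lemma star0 : star (0 : A) = 0.
Proof. by apply: (addrI (star 0)); rewrite -starD !addr0. Qed.
Lemma starN a : star (- a) = - star a.
Proof. by apply: (addrI (star a)); rewrite -starD !subrr star0. Qed.
Lemma starB a b : star (a - b) = star a - star b.
Proof. by rewrite starD starN. Qed.
Lemma star1 : star (1 : A) = 1.
Proof. by rewrite -[LHS]mulr1 -{2}[1]starK -star_mul mulr1 starK. Qed.
Lemma star_sum I (r : seq I) (P : pred I) (f : I -> A) :
  star (\sum_(i <- r | P i) f i) = \sum_(i <- r | P i) star (f i).
Proof. exact: (big_morph _ (@starD _ A) star0). Qed.
Lemma starZr (c : R) a : star (c%:C *: a) = c%:C *: star a.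
Proof. by rewrite starZ; congr (_ *: _); exact: conjc_real. Qed.

Lemma rnM a b : rn (a * b) <= rn a * rn b.
Proof. by rewrite -lecR rmorphM /= !rnE; exact: cstar_normM. Qed.
Lemma rn_cstar a : rn (star a * a) = rn a ^+ 2.
Proof. by apply: complexI; rewrite rmorphXn /= !rnE; exact: cstar_identity. Qed.
(** The identity |a|^2 = |star a * a| <= |star a| |a| gives one inequality;
    applied to star a it gives the other. *)
Lemma rn_star a : rn (star a) = rn a.
Proof.
suff h b : rn b <= rn (star b) by apply/eqP; rewrite eq_le h -{2}[a]starK h.
have := rnM (star b) b; rewrite rn_cstar expr2.
have [|b0] := ltP 0 (rn b); first by move=> b0; rewrite ler_pM2r.
by move=> _; rewrite (le_trans b0)// rn_ge0.
Qed.
Lemma rn1 : rn (1 : A) <= 1.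
Proof.
have := rn_cstar 1; rewrite star1 mulr1 expr2 => h.
have [->//|h1] := eqVneq (rn (1 : A)) 0.
by rewrite le_eqVlt; apply/orP; left; apply/eqP/(mulfI h1); rewrite -h mulr1.
Qed.

Lemma tends_mull (u : nat -> A) l b : tends u l -> tends (fun n => b * u n) (b * l).
Proof.
move=> ul; apply: (@tends_map _ _ _ (fun x => b * x) (rn b) u l _ _ ul) => [x y|v]; last exact: rnM.
by rewrite mulrBr.
Qed.
Lemma tends_mulr (u : nat -> A) l b : tends u l -> tends (fun n => u n * b) (l * b).
Proof.
move=> ul; have h := @tends_map R A A (fun x => x * b) (rn b) u l.
apply: h ul => [x y|v]; last first.
  by rewrite mulrC; exact: rnM.
by rewrite mulrBl.
Qed.
Lemma tends_star (u : nat -> A) l : tends u l -> tends (fun n => star (u n)) (star l).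
Proof.
move=> ul; apply: (@tends_map _ _ _ (@star R A) 1 u l _ _ ul) => [x y|v]; first exact: starB.
by rewrite mul1r rn_star.
Qed.
Lemma tendsZ (V : normedModType R[i]) (u : nat -> V) l (c : R[i]) :
  tends u l -> tends (fun n => c *: u n) (c *: l).
Proof.
move=> ul; apply: (@tends_map _ _ _ (fun x => c *: x) (rn c) u l _ _ ul) => [x y|v]; last by rewrite rnZ.
by rewrite scalerBr.
Qed.

End Algebra.

(** * Order and norm seen in a representation *)

Section Rep.
Context (R : realType) (H : completeNormedModType R[i]) (ip : H -> H -> R[i]).
Context (Hip : hilbert_product ip).

Lemma ip_psd : psd_form ip.
Proof.
case: Hip => h1 h2 h3; split=> // x.
by rewrite h3 exprn_ge0.
Qed.

Lemma ip_norm x : ip x x = (rn x ^+ 2)%:C.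
Proof. by case: Hip => _ _ ->; rewrite rmorphXn /= rnE. Qed.

Lemma ip_cs x y : rn (ip x y) <= rn x * rn y.
Proof.
have := cauchy_schwarz x y ip_psd; rewrite !ip_norm /= -exprMn.
by rewrite ler_pXn2r// ?nnegrE ?mulr_ge0 ?rn_ge0.
Qed.

Lemma sum_ip_psd (I : Type) (r : seq I) :
  psd_form (fun x y : I -> H => \sum_(i <- r) ip (x i) (y i)).
Proof.
split=> [c x y z|x y|x].
- rewrite mulr_sumr -big_split /=; apply: eq_bigr => i _.
  by case: Hip => -> _ _.
- rewrite conjc_sum; apply: eq_bigr => i _.
  by case: Hip => _ -> _.
- by apply: sumr_ge0 => i _; rewrite ip_norm ler0c exprn_ge0 ?rn_ge0.
Qed.

Context (A : cstarAlgType R) (pi : A -> {linear H -> H}).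
Context (Hpi : isometric_representation ip pi).

Lemma repZD (c : R[i]) a b h : pi (c *: a + b) h = c *: pi a h + pi b h.
Proof. by case: Hpi. Qed.
Lemma repM a b h : pi (a * b) h = pi a (pi b h).
Proof. by case: Hpi. Qed.
Lemma rep1 h : pi 1 h = h.
Proof. by case: Hpi. Qed.
Lemma rep_star a h k : ip (pi a h) k = ip h (pi (star a) k).
Proof. by case: Hpi. Qed.
Lemma repD a b h : pi (a + b) h = pi a h + pi b h.
Proof. by rewrite -[a]scale1r repZD !scale1r. Qed.
Lemma rep0 h : pi 0 h = 0.
Proof. by apply: (addrI (pi 0 h)); rewrite -repD !addr0. Qed.
Lemma repZ c a h : pi (c *: a) h = c *: pi a h.
Proof. by rewrite -[c *: a]addr0 repZD rep0 addr0. Qed.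
Lemma repN a h : pi (- a) h = - pi a h.
Proof. by rewrite -scaleN1r repZ scaleN1r. Qed.
Lemma repB a b h : pi (a - b) h = pi a h - pi b h.
Proof. by rewrite repD repN. Qed.
Lemma rep_sum I (r : seq I) (P : pred I) (f : I -> A) h :
  pi (\sum_(i <- r | P i) f i) h = \sum_(i <- r | P i) pi (f i) h.
Proof. exact: (big_morph (fun a => pi a h) (fun a b => repD a b h) (rep0 h)). Qed.

Lemma rep_le0 a : (forall h, rn (pi a h) <= 0) -> rn a <= 0.
Proof.
move=> a0; case: Hpi => _ _ _ _ /(_ a 0 (lexx _))[_].
by rewrite -lecR rnE; apply => h; rewrite mul0r -rnE lecR.
Qed.

Lemma rep_faithful a b : (forall h, pi a h = pi b h) -> a = b.
Proof.
move=> ab; apply/subr0_eq/rn_eq0/eqP; rewrite eq_le rn_ge0 andbT.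
by apply: rep_le0 => h; rewrite repB ab subrr rn0.
Qed.

Lemma rep_le a h : rn (pi a h) <= rn a * rn h.
Proof.
case: Hpi => _ _ _ _ /(_ a `|a| (normr_ge0 _))[/(_ (lexx _))/(_ h) + _].
by rewrite -lecR rmorphM /= !rnE.
Qed.

Lemma rn_op_le a (r : R) : 0 <= r -> (forall h, rn (pi a h) <= r * rn h) ->
  rn a <= r.
Proof.
move=> r0 hr; have r0' : 0 <= r%:C by rewrite ler0c.
case: Hpi => _ _ _ _ /(_ a r%:C r0')[_].
rewrite -lecR rnE; apply => h.
by rewrite -!rnE -rmorphM /= lecR.
Qed.

(** Positivity of a in A, tested on the Hilbert space of the representation,
    where sums and limits of positive elements are immediate. *)
Definition pos (a : A) : Prop := star a = a /\ forall h, 0 <= ip h (pi a h).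

Lemma pos_psd a : pos a -> psd_form (fun h k => ip h (pi a k)).
Proof.
move=> [sa pa]; split=> [c x y z|x y|//].
  by rewrite linearP; case: Hip => -> _ _.
by rewrite [in LHS](psdC ip_psd) rep_star sa.
Qed.

(** The numerical radius controls the norm of a positive element: apply the
    inequality of Cauchy and Schwarz for the form <h, a k> at h = a k. *)
Lemma pos_norm a (r : R) : pos a -> 0 <= r ->
  (forall h, complex.Re (ip h (pi a h)) <= r * rn h ^+ 2) -> rn a <= r.
Proof.
move=> pa r0 hr; apply: rn_op_le => // h.
have := cauchy_schwarz (pi a h) h (pos_psd pa).
rewrite ip_norm rnC ger0_norm ?exprn_ge0 ?rn_ge0// => cs.
have pge0 k : 0 <= complex.Re (ip k (pi a k)).
  by have [_ /(_ k)] := pa; rewrite lecE => /andP[].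
have {cs} := le_trans cs (ler_pM (pge0 _) (pge0 _) (hr _) (hr _)).
have -> : r * rn (pi a h) ^+ 2 * (r * rn h ^+ 2) =
  rn (pi a h) ^+ 2 * (r * rn h) ^+ 2 by ring.
rewrite [X in X <= _]expr2.
have [->|h0] := eqVneq (rn (pi a h)) 0; first by rewrite mulr_ge0 ?rn_ge0.
rewrite ler_pM2l ?exprn_gt0 ?lt_def ?h0 ?rn_ge0//.
by rewrite ler_pXn2r// ?nnegrE ?mulr_ge0 ?rn_ge0.
Qed.

Lemma pos_quad_le a h : complex.Re (ip h (pi a h)) <= rn a * rn h ^+ 2.
Proof.
apply: (@le_trans _ _ (rn (ip h (pi a h)))).
  by rewrite -lecR rnE (le_trans _ (normc_ge_Re _))// lecR ler_norm.
rewrite (le_trans (ip_cs _ _))// mulrC expr2 mulrA ler_wpM2r ?rn_ge0//.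
exact: rep_le.
Qed.

Lemma pos_mono a b : pos a -> pos (b - a) -> rn a <= rn b.
Proof.
move=> pa [_ pba]; apply: pos_norm => // [|h]; first exact: rn_ge0.
apply: (le_trans _ (pos_quad_le b h)).
have := pba h; rewrite repB (psdBr ip_psd) subr_ge0 lecE => /andP[_ //].
Qed.

Lemma posD a b : pos a -> pos b -> pos (a + b).
Proof.
move=> [sa pa] [sb pb]; split=> [|h]; first by rewrite starD sa sb.
by rewrite repD (psdDr ip_psd) addr_ge0.
Qed.

Lemma posZ (t : R) a : 0 <= t -> pos a -> pos (t%:C *: a).
Proof.
move=> t0 [sa pa]; split=> [|h]; first by rewrite starZr sa.
by rewrite repZ (psdZr ip_psd) mulr_ge0 // ler0c.
Qed.

Lemma pos_star_mul a : pos (star a * a).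
Proof.
split=> [|h]; first by rewrite star_mul starK.
by rewrite repM -{1}[a]starK -rep_star starK ip_norm ler0c exprn_ge0 ?rn_ge0.
Qed.

Lemma pos0 : pos 0.
Proof. by split=> [|h]; rewrite ?star0 // rep0 (psd0r ip_psd). Qed.

Lemma pos_gram I (r : seq I) (x : I -> A) :
  pos (\sum_(i <- r) star (x i) * x i).
Proof.
elim/big_ind: _ => [|a b|i _]; [exact: pos0|exact: posD|exact: pos_star_mul].
Qed.

Lemma ip_gram I (r : seq I) (x y : I -> A) h k :
  ip h (pi (\sum_(i <- r) star (x i) * y i) k) =
  \sum_(i <- r) ip (pi (x i) h) (pi (y i) k).
Proof.
rewrite rep_sum (psd_sumr ip_psd); apply: eq_bigr => i _.
by rewrite repM rep_star.
Qed.

(** The inequality of Cauchy and Schwarz in the Hilbert module A^r, read off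
    from the one in the direct sum of copies of the Hilbert space. *)
Lemma gram_cs_rep I (r : seq I) (x y : I -> A) :
  rn (\sum_(i <- r) star (x i) * y i) ^+ 2 <=
  rn (\sum_(i <- r) star (x i) * x i) * rn (\sum_(i <- r) star (y i) * y i).
Proof.
set a := \sum_(i <- r) star (x i) * x i; set b := \sum_(i <- r) star (y i) * y i.
set c := \sum_(i <- r) _.
have ab0 : 0 <= rn a * rn b by rewrite mulr_ge0 ?rn_ge0.
suff : rn c <= Num.sqrt (rn a * rn b).
  rewrite -[_ <= Num.sqrt _](@ler_pXn2r _ 2%N) ?nnegrE ?rn_ge0 ?sqrtr_ge0//.
  by rewrite sqr_sqrtr.
apply: rn_op_le => [|k]; first exact: sqrtr_ge0.
(* Testing against h = c k makes <h, c k> the square of the norm to bound. *)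
set h := pi c k.
have := cauchy_schwarz (fun i => pi (x i) h) (fun i => pi (y i) k) (sum_ip_psd r).
rewrite -!ip_gram -/a -/b -/c -/h ip_norm rnC ger0_norm ?exprn_ge0 ?rn_ge0//.
move=> cs.
have q0 z : 0 <= complex.Re (ip z (pi a z)).
  by have [_ /(_ z)] := pos_gram r x; rewrite lecE => /andP[].
have q0' z : 0 <= complex.Re (ip z (pi b z)).
  by have [_ /(_ z)] := pos_gram r y; rewrite lecE => /andP[].
have {cs} := le_trans cs (ler_pM (q0 _) (q0' _) (pos_quad_le _ _) (pos_quad_le _ _)).
have -> : rn a * rn h ^+ 2 * (rn b * rn k ^+ 2) =
  rn h ^+ 2 * (Num.sqrt (rn a * rn b) * rn k) ^+ 2.
  by rewrite [(Num.sqrt _ * _) ^+ 2]exprMn sqr_sqrtr//; ring.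
rewrite [X in X <= _]expr2.
have [->|h0] := eqVneq (rn h) 0.
  by rewrite mulr_ge0 ?rn_ge0 ?sqrtr_ge0.
rewrite ler_pM2l ?exprn_gt0 ?lt_def ?h0 ?rn_ge0//.
by rewrite ler_pXn2r// ?nnegrE ?mulr_ge0 ?rn_ge0 ?sqrtr_ge0.
Qed.

End Rep.

(** * Majorized iterations and spectral cutoff *)

Lemma nondecr_cauchy (R : realType) (t : nat -> R) (b : R) :
  (forall n, t n <= t n.+1) -> (forall n, t n <= b) ->
  forall e : R, 0 < e -> exists N, forall m n, (N <= m <= n)%N -> t n - t m <= e.
Proof.
move=> tS tb e e0.
have tmono : {homo t : m n / (m <= n)%N >-> m <= n}.
  by apply: homo_leq => // x y z; exact: le_trans.
have tub : has_ubound (range t) by exists b => _ [n _ <-].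
have tcvg := nondecreasing_cvgn (fun m n => @tmono m n) tub.
have [N _ HN] : \forall n \near \oo, `|sup (range t) - t n| <= e.
  by move/cvgrPdist_le: tcvg; apply.
have tl n : t n <= sup (range t).
  by apply: sup_upper_bound; [split; [by exists (t 0%N), 0%N|by exists b => _ [k _ <-]]|exists n].
exists N => m n /andP[Nm mn].
have := HN _ Nm; rewrite ger0_norm ?subr_ge0//; have := tl n; lra.
Qed.

Section FixedPoints.
Context (R : realType) (A : cstarAlgType R).
Implicit Types x y z : A.

(** Kantorovich's majorant method: the iterates of f from 0 are dominated step
    by step by those of the scalar map g on [0, 1], which increase and are
    bounded, so that they converge.  Since f need not be a contraction, this
    applies to square roots. *)
Lemma majorant_fixpoint (f : A -> A) (g : R -> R) :
  (forall x x' s s', 0 <= s' <= s -> s <= 1 -> rn x' <= s' -> rn x <= s ->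
     rn (x - x') <= s - s' -> rn (f x - f x') <= g s - g s') ->
  rn (f 0) <= g 0 -> (forall s, 0 <= s <= 1 -> 0 <= g s <= 1) ->
  (forall u l, tends u l -> tends (f \o u) (f l)) ->
  exists y, [/\ f y = y, rn y <= 1
    & forall z, (forall x, z * x = x * z -> z * f x = f x * z) -> z * y = y * z].
Proof.
move=> fg f0 g01 fc.
pose u k := iter k f 0; pose t k := iter k g 0.
have t01 k : 0 <= t k <= 1.
  by elim: k => [|k IH] /=; [rewrite lexx ler01|exact: g01].
have ut k : rn (u k) <= t k /\ rn (u k.+1 - u k) <= t k.+1 - t k.
  elim: k => [|k [IH1 IH2]]; first by rewrite /= rn0 lexx !subr0.
  have tk : t k <= t k.+1 by rewrite -subr_ge0 (le_trans _ IH2)// rn_ge0.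
  have uk1 : rn (u k.+1) <= t k.+1.
    rewrite -[u _](subrK (u k)) (le_trans (rnD _ _))//; lra.
  split=> //; apply: fg => //; last by case/andP: (t01 k.+1).
  by rewrite tk andbT; case/andP: (t01 k).
have tS k : t k <= t k.+1.
  by rewrite -subr_ge0 (le_trans _ (ut k).2)// rn_ge0.
have utD k j : rn (u (k + j)%N - u k) <= t (k + j)%N - t k.
  elim: j => [|j IH]; first by rewrite addn0 !subrr rn0.
  have := (ut (k + j)%N).2; rewrite addnS => h.
  have := rnD (u (k + j).+1 - u (k + j)%N) (u (k + j)%N - u k).
  by rewrite addrA subrK; lra.
have [|y uy] := @cauchy_tends _ A u.
  move=> e e0; have [|N HN] := nondecr_cauchy tS _ e0 (b := 1).
    by move=> n; case/andP: (t01 n).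
  exists N => m n Nmn; apply: le_trans (HN _ _ Nmn).
  by case/andP: Nmn => _ /subnKC <-; exact: utD.
exists y; split.
- apply: (tends_unique (fc _ _ uy)).
  by apply: (tends_eq _ (tends_comp (f := succn) _ uy)).
- by apply: (tends_le _ uy) => n; rewrite (le_trans (ut n).1)//; case/andP: (t01 n).
- move=> z zf; apply: (tends_unique (tends_mull z uy)).
  apply: (tends_eq _ (tends_mulr z uy)) => n.
  by elim: n => [|n IH]; [rewrite mulr0 mul0r|rewrite [u _]/= -/(u n) zf].
Qed.

Lemma tendsM (u v : nat -> A) l k :
  tends u l -> tends v k -> tends (fun n => u n * v n) (l * k).
Proof.
move=> ul vk e e0.
have bl : 0 < rn l + 1 by rewrite ltr_wpDl ?rn_ge0.
have bk : 0 < rn k + 1 by rewrite ltr_wpDl ?rn_ge0.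
have [|N1 H1] := ul (e / 2 / (rn k + 1)); first by rewrite !divr_gt0.
have [|N2 H2] := vk (e / 2 / (rn l + 1)); first by rewrite !divr_gt0.
have [|N3 H3] := tends_rn _ vk (e := 1) => //.
exists (maxn N1 (maxn N2 N3)) => n; rewrite !geq_max => /and3P[n1 n2 n3].
have -> : u n * v n - l * k = (u n - l) * v n + l * (v n - k).
  by rewrite mulrBl mulrBr addrA subrK.
have {}H1 := H1 n n1; have {}H2 := H2 n n2; have {H3} [_ H3] := H3 n n3.
have e1 : rn ((u n - l) * v n) <= e / 2.
  rewrite (le_trans (rnM _ _))// (le_trans (ler_pM _ _ H1 H3)) ?rn_ge0//.
  by rewrite divfK ?gt_eqF.
have e2 : rn (l * (v n - k)) <= e / 2.
  rewrite (le_trans (rnM _ _))//.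
  have l1 : rn l <= rn l + 1 by rewrite lerDl.
  rewrite (le_trans (ler_pM _ _ l1 H2)) ?rn_ge0// mulrC.
  by rewrite divfK ?gt_eqF.
rewrite (le_trans (rnD _ _))//; lra.
Qed.

Let half x : A := (2^-1)%:C *: x.

Let halfK x : half (x + x) = x.
Proof.
rewrite /half scalerDr -scalerDl -rmorphD /=.
have -> : 2^-1 + 2^-1 = 1 :> R by lra.
by rewrite rmorph1 scale1r.
Qed.

Let half_eq x y : half x = y -> x = y + y.
Proof. by move=> <-; rewrite -{1}[x]halfK /half scalerDr. Qed.

Let rn_half x : rn (half x) = rn x / 2.
Proof. by rewrite rnZ rnC ger0_norm ?invr_ge0// mulrC. Qed.

(** The solution y = 1 - sqrt(1 - d), as the limit of
    y := (d + y^2) / 2; the majorant is s := (1 + s^2) / 2, whose fixed point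
    is 1. *)
Lemma quadratic_root (d : A) : rn d <= 1 ->
  exists y, [/\ y + y = d + y * y, rn y <= 1
    & forall z, z * d = d * z -> z * y = y * z].
Proof.
move=> d1.
have [||||y [fy y1 yc]] := @majorant_fixpoint (fun x => half (d + x * x))
    (fun s => (1 + s ^+ 2) / 2).
- move=> x x' s s' /andP[s0 ss'] s1 xs xs' xx.
  rewrite /half -scalerBr rn_half opprD addrACA subrr add0r -mulrBl.
  have -> : x * x - x' * x' = (x - x') * x + x' * (x - x').
    by rewrite mulrBl mulrBr addrA subrK.
  have -> : 1 + s ^+ 2 - (1 + s' ^+ 2) = (s - s') * s + s' * (s - s') by ring.
  rewrite ler_pM2r ?invr_gt0// (le_trans (rnD _ _))// lerD//.
  + by rewrite (le_trans (rnM _ _))// ler_pM ?rn_ge0.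
  + by rewrite (le_trans (rnM _ _))// ler_pM ?rn_ge0.
- by rewrite rn_half mulr0 addr0 expr0n addr0 ler_pM2r ?invr_gt0.
- move=> s /andP[s0 s1]; apply/andP; split; first by rewrite divr_ge0// addr_ge0// sqr_ge0.
  have : s ^+ 2 <= 1 by rewrite exprn_ile1.
  lra.
- by move=> u l ul; apply: tendsZ; apply: tendsD; [exact: tends_cst|exact: tendsM].
exists y; split=> //; first by move/half_eq: fy.
move=> z zd; apply: yc => x zx; rewrite /half -scA_l -scA_r; congr (_ *: _).
by rewrite mulrDr mulrDl zd; congr (_ + _); rewrite mulrA zx -mulrA zx mulrA.
Qed.

(** The inverse w of 2 - y, as the limit of w := (1 + y w) / 2. *)
Lemma two_sub_inverse (y : A) : rn y <= 1 ->
  exists w, [/\ w + w = 1 + y * w, rn w <= 1 & y * w = w * y].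
Proof.
move=> y1.
have [||||w [fw w1 wc]] := @majorant_fixpoint (fun x => half (1 + y * x))
    (fun s => (1 + s) / 2).
- move=> x x' s s' /andP[s0 ss'] s1 xs xs' xx.
  rewrite /half -scalerBr rn_half opprD addrACA subrr add0r -mulrBr -mulrBl.
  have -> : 1 + s - (1 + s') = s - s' by ring.
  rewrite ler_pM2r ?invr_gt0// (le_trans (rnM _ _))//.
  by rewrite -[s - s']mul1r ler_pM ?rn_ge0.
- by rewrite rn_half mulr0 !addr0 ler_pM2r ?invr_gt0// rn1.
- by move=> s /andP[s0 s1]; lra.
- by move=> u l ul; apply: tendsZ; apply: tendsD; [exact: tends_cst|exact: tends_mull].
exists w; split=> //; first by move/half_eq: fw.
apply: wc => x zx; rewrite /half -scA_l -scA_r; congr (_ *: _).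
by rewrite mulrDr mulrDl mul1r mulr1 -mulrA -zx.
Qed.

End FixedPoints.

Section Cutoff.
Context (R : realType) (H : completeNormedModType R[i]) (ip : H -> H -> R[i]).
Context (Hip : hilbert_product ip).
Context (A : cstarAlgType R) (pi : A -> {linear H -> H}).
Context (Hpi : isometric_representation ip pi).

(** The operator inequality a^2 <= |a| a. *)
Lemma pos_sq_le a h : pos ip pi a ->
  rn (pi a h) ^+ 2 <= rn a * complex.Re (ip h (pi a h)).
Proof.
move=> pa; have := cauchy_schwarz (pi a h) h (pos_psd Hip Hpi pa).
rewrite (ip_norm Hip) rnC ger0_norm ?exprn_ge0 ?rn_ge0//.
have q0 : 0 <= complex.Re (ip h (pi a h)).
  by have [_ /(_ h)] := pa; rewrite lecE => /andP[].
move=> cs; have {cs} := le_trans cs (ler_wpM2r q0 (pos_quad_le Hip Hpi a _)).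
rewrite mulrAC mulrC [X in X <= _]expr2.
have [->|h0] := eqVneq (rn (pi a h)) 0.
  by rewrite expr0n mulr_ge0 ?rn_ge0.
by rewrite ler_pM2l// exprn_gt0// lt_def h0 rn_ge0.
Qed.

(** The element h plays the part of a spectral projection of a for [1/2, 1].
    With b = 2 a - 1 and its modulus |b|, put h = |b| + b, twice the positive
    part of b; then b h = |b| h, that is 2 a h = (1 + |b|) h, and 1 + |b| is
    invertible. *)
Lemma cutoff_rep a : pos ip pi a -> rn a = 1 ->
  exists c h : A, [/\ rn c <= 2, h <> 0 & c * a * h = h].
Proof.
move=> pa a1; have [sa _] := pa.
have [b bdef] : {b : A | b = a + a - 1} by exists (a + a - 1).
pose d : A := 1 - b * b.
have sb : star b = b by rewrite bdef starB starD star1 sa.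
have d1 : rn d <= 1.
  have dq h : ip h (pi d h) = (rn h ^+ 2 - rn (pi b h) ^+ 2)%:C.
    rewrite (repB Hpi) (psdBr (ip_psd Hip)) (rep1 Hpi) (repM Hpi) -{1}sb -(rep_star Hpi).
    by rewrite !(ip_norm Hip) -rmorphB.
  have bq h : rn (pi b h) ^+ 2 <= rn h ^+ 2.
    have q := pos_sq_le h pa; rewrite a1 mul1r in q.
    have := ip_norm Hip (pi b h).
    have bE : pi b h = pi a h + pi a h - h.
      by rewrite bdef (repB Hpi) (repD Hpi) (rep1 Hpi).
    have r0 : ip h (pi a h) = (complex.Re (ip h (pi a h)))%:C.
      by have [_ /(_ h) /ger0_real /RRe_real] := pa.
    have r1 : ip (pi a h) h = (complex.Re (ip h (pi a h)))%:C.
      by rewrite (psdC (ip_psd Hip)) r0 conjc_real.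
    rewrite {1 2}bE !(psdBl (ip_psd Hip), psdBr (ip_psd Hip), psdDl (ip_psd Hip), psdDr (ip_psd Hip)) r0 r1 !(ip_norm Hip).
    rewrite -!(rmorphD, rmorphB) /= => /complexI.
    lra.
  apply: (pos_norm Hip Hpi) => //; first split=> [|h].
  - by rewrite starB star1 star_mul sb.
  - by rewrite dq ler0c subr_ge0.
  - by move=> h; rewrite dq /= mul1r gerBl exprn_ge0 ?rn_ge0.
(* Here y = 1 - |b|, since (1 - y)^2 = b^2; below, p is |b|. *)
have [y [yE y1 yc]] := quadratic_root d1.
have yb : b * y = y * b by apply: yc; rewrite /d mulrBr mulrBl mulr1 mul1r mulrA.
(* The inverse of 2 - y = 1 + |b|. *)
have [w [wE w1 wc]] := two_sub_inverse y1.
have [p pE] : {p : A | p = 1 - y} by exists (1 - y).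
have bp : b * p = p * b by rewrite pE mulrBr mulrBl mulr1 mul1r yb.
have pp : p * p = b * b.
  rewrite {2}pE mulrBr mulr1 {1 2}pE mulrBl mul1r opprB addrA.
  by rewrite addrAC -[1 - y - y]addrA -opprD yE opprD addrA subrK subKr.
have [h hE] : {h : A | h = p + b} by exists (p + b).
have bh : b * h = p * h by rewrite hE !mulrDr bp pp addrC.
exists (w + w), h; split.
- by rewrite (le_trans (rnD _ _))//; lra.
(* If h vanished, then |b| = - b and y = 2 a would have norm 2. *)
- move=> h0; have ya : y = a + a.
    have : a + a - y = h by rewrite hE bdef pE [1 - y + _]addrC addrA subrK.
    by rewrite h0 => /subr0_eq.
  have : rn y = 2.
    rewrite ya -[a]scale1r -scalerDl rnZ a1 mulr1.
    have -> : 1 + 1 = 2%:C :> R[i] by rewrite -[2 in RHS]/(1 + 1) rmorphD.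
    by rewrite rnC ger0_norm.
  by move=> y2; move: y1; rewrite y2; lra.
- have -> : (w + w) * a * h = w * ((a + a) * h).
    by rewrite mulrA mulrDr !mulrDl.
  have -> : (a + a) * h = h + h - y * h.
    move: bh; rewrite {1}bdef pE !mulrBl mul1r => /(congr1 (fun x => x + h)).
    by rewrite subrK => ->; rewrite addrAC.
  rewrite mulrBr mulrDr -mulrDl wE mulrDl mul1r !mulrA -wc.
  by rewrite addrK.
Qed.

End Cutoff.

(** * The Hilbert module of square summable sequences *)

Section WStar.
Context (R : realType) (A : cstarAlgType R) (HA : is_wstar A).

Lemma gram_cs I (r : seq I) (x y : I -> A) :
  rn (\sum_(i <- r) star (x i) * y i) ^+ 2 <=
  rn (\sum_(i <- r) star (x i) * x i) * rn (\sum_(i <- r) star (y i) * y i).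
Proof. case: HA => H [ip [pi [Hip Hpi _]]]; exact: (gram_cs_rep Hip Hpi). Qed.

Lemma gram_le I (r : seq I) J (s : seq J) (t : R) (x : I -> A) (y : J -> A) : 0 <= t ->
  rn (\sum_(i <- r) star (x i) * x i) <=
  rn (\sum_(i <- r) star (x i) * x i + t%:C *: \sum_(j <- s) star (y j) * y j).
Proof.
case: HA => H [ip [pi [Hip Hpi _]]] t0; apply: (pos_mono Hip Hpi).
  exact: (pos_gram Hip Hpi).
rewrite addrAC subrr add0r; apply: (posZ Hip Hpi) => //.
exact: (pos_gram Hip Hpi).
Qed.

Lemma gram_cutoff I (r : seq I) (x : I -> A) :
  rn (\sum_(i <- r) star (x i) * x i) = 1 ->
  exists c h : A, [/\ rn c <= 2, h <> 0
    & c * (\sum_(i <- r) star (x i) * x i) * h = h].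
Proof.
case: HA => H [ip [pi [Hip Hpi _]]]; apply: (cutoff_rep Hip Hpi).
exact: (pos_gram Hip Hpi).
Qed.

End WStar.

Section Nonneg.
Context (R : realType).

Lemma le_sqr (a b : R) : 0 <= b -> a ^+ 2 <= b ^+ 2 -> a <= b.
Proof.
move=> b0; have [a0|a0] := leP 0 a; first by rewrite ler_pXn2r.
by move=> _; lra.
Qed.

Lemma sqrtC_real (r : R) : 0 <= r -> sqrtC (r%:C) = (Num.sqrt r)%:C.
Proof.
move=> r0; have s0 : 0 <= (Num.sqrt r)%:C by rewrite ler0c sqrtr_ge0.
by rewrite -[r in LHS]sqr_sqrtr// rmorphXn /= sqrCK.
Qed.

Lemma sqrt_le (a b : R) : 0 <= b -> a <= b ^+ 2 -> Num.sqrt a <= b.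
Proof.
move=> b0 ab; have [a0|a0] := leP 0 a; last by rewrite ltr0_sqrtr.
by apply: le_sqr => //; rewrite sqr_sqrtr.
Qed.

End Nonneg.

Section L2.
Context (R : realType) (A : cstarAlgType R) (HA : is_wstar A).
Implicit Types x y z : nat -> A.

Definition psum x y (n : nat) : A := \sum_(0 <= i < n) star (x i) * y i.

Lemma psum_sub x y m n : (m <= n)%N ->
  psum x y n - psum x y m = \sum_(m <= i < n) star (x i) * y i.
Proof. by move=> mn; rewrite /psum (big_cat_nat (n := m))//= addrAC subrr add0r. Qed.

Lemma l2P x : l2 A x <-> cauchyR (psum x x).
Proof.
split=> [/cvg_tends/tends_cauchy//|/cauchy_tends[l]]; exact: tends_cvg.
Qed.

Lemma l2ip_tends x y : l2 A x -> l2 A y -> tends (psum x y) (l2ip x y).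
Proof.
move=> /l2P lx /l2P ly; apply: (@cvg_tends _ A (psum x y)).
have [|l] := @cauchy_tends _ A (psum x y); last exact: tends_cvg.
move=> e e0; have [N1 H1] := lx e e0; have [N2 H2] := ly e e0.
exists (maxn N1 N2) => m n; rewrite geq_max => /andP[/andP[N1m N2m] mn].
rewrite psum_sub//; apply: le_sqr; first exact: ltW.
apply: (le_trans (gram_cs HA _ _ _)); rewrite expr2.
apply: ler_pM; rewrite ?rn_ge0// -psum_sub//.
- by apply: H1; rewrite N1m.
- by apply: H2; rewrite N2m.
Qed.

Lemma l2_of_tends x l : tends (psum x x) l -> l2 A x.
Proof. exact: tends_cvg. Qed.

Lemma l2ip_of_tends x y l : tends (psum x y) l -> l2ip x y = l.
Proof. exact: tends_lim. Qed.

Lemma psumDl x y z n : psum (x + y) z n = psum x z n + psum y z n.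
Proof.
rewrite -big_split /=; apply: eq_bigr => i _.
by rewrite starD mulrDl.
Qed.
Lemma psumDr x y z n : psum z (x + y) n = psum z x n + psum z y n.
Proof. by rewrite -big_split /=; apply: eq_bigr => i _; rewrite mulrDr. Qed.
Lemma psumZl (c : R[i]) x y n : psum (c *: x) y n = c^*%C *: psum x y n.
Proof.
rewrite scaler_sumr; apply: eq_bigr => i _.
by rewrite -[(c *: x) i]/(c *: x i) starZ scA_l.
Qed.
Lemma psumZr (c : R[i]) x y n : psum x (c *: y) n = c *: psum x y n.
Proof. by rewrite scaler_sumr; apply: eq_bigr => i _; rewrite scA_r. Qed.
Lemma psum_ractl x y a n : psum (ract x a) y n = star a * psum x y n.
Proof.
by rewrite mulr_sumr; apply: eq_bigr => i _; rewrite star_mul mulrA.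
Qed.
Lemma psum_ractr x y a n : psum x (ract y a) n = psum x y n * a.
Proof. by rewrite mulr_suml; apply: eq_bigr => i _; rewrite mulrA. Qed.
Lemma psum_star x y n : star (psum x y n) = psum y x n.
Proof. by rewrite star_sum; apply: eq_bigr => i _; rewrite star_mul starK. Qed.

Lemma l2D x y : l2 A x -> l2 A y -> l2 A (x + y).
Proof.
move=> lx ly; apply: l2_of_tends.
have h := tendsD (tendsD (l2ip_tends lx lx) (l2ip_tends ly lx))
  (tendsD (l2ip_tends lx ly) (l2ip_tends ly ly)).
by apply: (tends_eq _ h) => n; rewrite psumDr !psumDl.
Qed.
Lemma l2Z (c : R[i]) x : l2 A x -> l2 A (c *: x).
Proof.
move=> lx; apply: l2_of_tends.
have h := tendsZ c (tendsZ c^*%C (l2ip_tends lx lx)).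
by apply: (tends_eq _ h) => n; rewrite psumZr !psumZl.
Qed.
Lemma l2_ract x a : l2 A x -> l2 A (ract x a).
Proof.
move=> lx; apply: l2_of_tends.
have h := tends_mulr a (tends_mull (star a) (l2ip_tends lx lx)).
by apply: (tends_eq _ h) => n; rewrite psum_ractr !psum_ractl.
Qed.
Lemma l2_0 : l2 A 0.
Proof.
apply: (@l2_of_tends _ 0); apply: (tends_eq _ (tends_cst 0)) => n.
by rewrite /psum big1// => i _; rewrite mulr0.
Qed.
Lemma l2N x : l2 A x -> l2 A (- x).
Proof. by rewrite -scaleN1r; exact: l2Z. Qed.
Lemma l2B x y : l2 A x -> l2 A y -> l2 A (x - y).
Proof. by move=> lx ly; apply: l2D => //; exact: l2N. Qed.
Lemma l2_sum I (r : seq I) (P : pred I) (f : I -> nat -> A) :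
  (forall i, P i -> l2 A (f i)) -> l2 A (\sum_(i <- r | P i) f i).
Proof. by move=> h; elim/big_ind: _ => //; [exact: l2_0|exact: l2D]. Qed.

Lemma l2ipDr x y z : l2 A x -> l2 A y -> l2 A z ->
  l2ip x (y + z) = l2ip x y + l2ip x z.
Proof.
move=> lx ly lz; apply: l2ip_of_tends.
apply: (tends_eq _ (tendsD (l2ip_tends lx ly) (l2ip_tends lx lz))) => n.
by rewrite psumDr.
Qed.
Lemma l2ipZr (c : R[i]) x y : l2 A x -> l2 A y -> l2ip x (c *: y) = c *: l2ip x y.
Proof.
move=> lx ly; apply: l2ip_of_tends.
by apply: (tends_eq _ (tendsZ c (l2ip_tends lx ly))) => n; rewrite psumZr.
Qed.
Lemma l2ip_ractr x y a : l2 A x -> l2 A y -> l2ip x (ract y a) = l2ip x y * a.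
Proof.
move=> lx ly; apply: l2ip_of_tends.
by apply: (tends_eq _ (tends_mulr a (l2ip_tends lx ly))) => n; rewrite psum_ractr.
Qed.
Lemma l2ip_star x y : l2 A x -> l2 A y -> star (l2ip x y) = l2ip y x.
Proof.
move=> lx ly; apply/esym/l2ip_of_tends.
by apply: (tends_eq _ (tends_star (l2ip_tends lx ly))) => n; rewrite psum_star.
Qed.
Lemma l2ipNr x y : l2 A x -> l2 A y -> l2ip x (- y) = - l2ip x y.
Proof. by move=> lx ly; rewrite -scaleN1r l2ipZr// scaleN1r. Qed.
Lemma l2ipBr x y z : l2 A x -> l2 A y -> l2 A z ->
  l2ip x (y - z) = l2ip x y - l2ip x z.
Proof. by move=> lx ly lz; rewrite l2ipDr ?l2ipNr//; exact: l2N. Qed.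
Lemma l2ipDl x y z : l2 A x -> l2 A y -> l2 A z ->
  l2ip (x + y) z = l2ip x z + l2ip y z.
Proof.
move=> lx ly lz; rewrite -l2ip_star// ?l2ipDr ?starD ?l2ip_star//; exact: l2D.
Qed.
Lemma l2ipZl (c : R[i]) x y : l2 A x -> l2 A y ->
  l2ip (c *: x) y = c^*%C *: l2ip x y.
Proof.
move=> lx ly; rewrite -l2ip_star// ?l2ipZr ?starZ ?l2ip_star//; exact: l2Z.
Qed.
Lemma l2ip_ractl x y a : l2 A x -> l2 A y ->
  l2ip (ract x a) y = star a * l2ip x y.
Proof.
move=> lx ly; rewrite -l2ip_star// ?l2ip_ractr ?star_mul ?l2ip_star//.
exact: l2_ract.
Qed.
Lemma l2ipNl x y : l2 A x -> l2 A y -> l2ip (- x) y = - l2ip x y.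
Proof.
move=> lx ly; rewrite -l2ip_star// ?l2ipNr// ?starN ?l2ip_star//; exact: l2N.
Qed.
Lemma l2ipBl x y z : l2 A x -> l2 A y -> l2 A z ->
  l2ip (x - y) z = l2ip x z - l2ip y z.
Proof. by move=> lx ly lz; rewrite l2ipDl ?l2ipNl//; exact: l2N. Qed.
Lemma l2ip0r x : l2ip x 0 = 0.
Proof.
apply: l2ip_of_tends; apply: (tends_eq _ (tends_cst 0)) => n.
by rewrite /psum big1// => i _; rewrite mulr0.
Qed.
Lemma l2ip0l x : l2ip 0 x = 0.
Proof.
apply: l2ip_of_tends; apply: (tends_eq _ (tends_cst 0)) => n.
by rewrite /psum big1// => i _; rewrite star0 mul0r.
Qed.
Lemma l2ip_sumr I (r : seq I) (f : I -> nat -> A) x :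
  l2 A x -> (forall i, l2 A (f i)) ->
  l2ip x (\sum_(i <- r) f i) = \sum_(i <- r) l2ip x (f i).
Proof.
move=> lx lf; elim: r => [|i r IH]; first by rewrite !big_nil l2ip0r.
by rewrite !big_cons l2ipDr// ?IH//; exact: l2_sum.
Qed.

Lemma tends_rn_le (V W : normedModType R[i]) (u : nat -> V) (v : nat -> W) l k :
  (forall n, rn (u n) <= rn (v n)) -> tends u l -> tends v k -> rn l <= rn k.
Proof.
move=> uv ul vk; apply/ler_addgt0Pr => e e0.
have e2 : 0 < e / 2 by rewrite divr_gt0.
have [N1 H1] := tends_rn e2 ul; have [N2 H2] := tends_rn e2 vk.
have [h1 _] := H1 _ (leq_maxl N1 N2); have [_ h2] := H2 _ (leq_maxr N1 N2).
have := uv (maxn N1 N2); lra.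
Qed.

Lemma l2ip_le (t : R) x y : l2 A x -> l2 A y -> 0 <= t ->
  rn (l2ip x x) <= rn (l2ip x x + t%:C *: l2ip y y).
Proof.
move=> lx ly t0.
have h := tendsD (l2ip_tends lx lx) (tendsZ t%:C (l2ip_tends ly ly)).
by apply: (tends_rn_le _ (l2ip_tends lx lx) h) => n; exact: (gram_le HA).
Qed.

(** Splitting off the terms outside of the block [m, n[ adds a positive element. *)
Lemma block_le x m n p q : (p <= m)%N -> (m <= n <= q)%N ->
  rn (\sum_(m <= i < n) star (x i) * x i) <= rn (\sum_(p <= i < q) star (x i) * x i).
Proof.
move=> pm /andP[mn nq].
rewrite [X in _ <= rn X](big_cat_nat (n := m))//=; last exact: leq_trans nq.
rewrite [X in _ <= rn (_ + X)](big_cat_nat (n := n))//= addrCA.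
rewrite -(big_cat _ _ _ (fun=> true)) /=.
have := gram_le HA (index_iota m n) (index_iota p m ++ index_iota n q) x x (@ler01 R).
by rewrite rmorph1 scale1r.
Qed.

Lemma psum_le x n : l2 A x -> rn (psum x x n) <= rn (l2ip x x).
Proof.
move=> lx; apply: (tends_ge (N := n) _ (l2ip_tends lx lx)) => m nm.
by apply: block_le => //; rewrite leq0n.
Qed.

Lemma l2_coord_le x i : l2 A x -> rn (x i) ^+ 2 <= rn (l2ip x x).
Proof.
move=> lx; apply: le_trans (psum_le i.+1 lx).
have := @block_le x i i.+1 0 i.+1 isT; rewrite leqnSn leqnn => /(_ isT).
by rewrite big_nat1 rn_cstar.
Qed.

Definition N2 x : R := Num.sqrt (rn (l2ip x x)).

Lemma N2_ge0 x : 0 <= N2 x.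
Proof. exact: sqrtr_ge0. Qed.
#[local] Hint Resolve N2_ge0 : core.
Lemma N2_sq x : N2 x ^+ 2 = rn (l2ip x x).
Proof. by rewrite sqr_sqrtr// rn_ge0. Qed.
Lemma l2normE x : l2norm x = (N2 x)%:C.
Proof. by rewrite /l2norm -rnE sqrtC_real// rn_ge0. Qed.

Lemma l2ip_cs x y : l2 A x -> l2 A y -> rn (l2ip x y) <= N2 x * N2 y.
Proof.
move=> lx ly; apply: (tends_le _ (l2ip_tends lx ly)) => n.
apply: le_sqr; first by rewrite mulr_ge0.
rewrite (le_trans (gram_cs HA _ _ _))// exprMn !N2_sq.
by rewrite ler_pM ?rn_ge0//; exact: psum_le.
Qed.

Lemma N20 : N2 0 = 0.
Proof. by rewrite /N2 l2ip0r rn0 sqrtr0. Qed.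
Lemma coord_le x i : l2 A x -> rn (x i) <= N2 x.
Proof. by move=> lx; apply: le_sqr => //; rewrite N2_sq; exact: l2_coord_le. Qed.
Lemma N2_eq0 x : l2 A x -> N2 x = 0 -> x = 0.
Proof.
move=> lx x0; apply/funext => i; apply: rn_eq0; apply/eqP.
by rewrite eq_le rn_ge0 andbT -x0 coord_le.
Qed.
Lemma N2Z (c : R[i]) x : l2 A x -> N2 (c *: x) = rn c * N2 x.
Proof.
move=> lx; rewrite /N2 l2ipZr ?l2ipZl//; last exact: l2Z.
rewrite !rnZ rn_conj mulrA sqrtrM ?mulr_ge0 ?rn_ge0// -expr2.
by rewrite sqrtr_sqr ger0_norm// rn_ge0.
Qed.
Lemma N2N x : N2 (- x) = N2 x.
Proof.
rewrite /N2 /l2ip; do 2 congr (_ _); congr (limn (series _)).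
by apply/funext => i; rewrite -[(- x) i]/(- x i) starN mulrNN.
Qed.
Lemma N2_ract x a : l2 A x -> N2 (ract x a) <= N2 x * rn a.
Proof.
move=> lx; apply: le_sqr; first by rewrite mulr_ge0// rn_ge0.
rewrite N2_sq l2ip_ractr ?l2ip_ractl//; last exact: l2_ract.
rewrite (le_trans (rnM _ _))// exprMn N2_sq expr2 mulrA ler_wpM2r ?rn_ge0//.
by rewrite (le_trans (rnM _ _))// rn_star mulrC.
Qed.

(** The estimate behind the triangle inequality: a and b are the squares of two
    vectors and c is their inner product. *)
Lemma cross_terms_le (a b c : A) (s t : R) : 0 <= s -> 0 <= t ->
  rn a <= s ^+ 2 -> rn b <= t ^+ 2 -> rn c <= s * t ->
  rn ((a + star c) + (c + b)) <= (s + t) ^+ 2.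
Proof.
move=> s0 t0 ha hb hc; rewrite (le_trans (rnD _ _))//.
have h1 := rnD a (star c); have h2 := rnD c b; rewrite rn_star in h1.
have -> : (s + t) ^+ 2 = s ^+ 2 + t ^+ 2 + s * t + s * t by ring.
lra.
Qed.

Lemma N2D x y : l2 A x -> l2 A y -> N2 (x + y) <= N2 x + N2 y.
Proof.
move=> lx ly; apply: sqrt_le; first by rewrite addr_ge0.
rewrite l2ipDr ?l2ipDl//; last exact: l2D.
rewrite -(l2ip_star lx ly); apply: cross_terms_le => //; rewrite ?N2_sq//.
exact: l2ip_cs.
Qed.

Lemma N2B x y : l2 A x -> l2 A y -> N2 (x - y) <= N2 x + N2 y.
Proof. by move=> lx ly; rewrite -(N2N y) N2D//; exact: l2N. Qed.

Lemma N2BC x y : N2 (x - y) = N2 (y - x).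
Proof. by rewrite -N2N opprB. Qed.

(** The norm of the part of x supported in [m, n[, defined for every sequence
    x, so that it may serve to prove that x is square summable. *)
Definition bnorm m n x : R := Num.sqrt (rn (\sum_(m <= i < n) star (x i) * x i)).

Lemma bnorm_sq m n x : bnorm m n x ^+ 2 = rn (\sum_(m <= i < n) star (x i) * x i).
Proof. by rewrite sqr_sqrtr// rn_ge0. Qed.

Lemma bnormD m n x y : bnorm m n (x + y) <= bnorm m n x + bnorm m n y.
Proof.
apply: sqrt_le; first by rewrite addr_ge0// sqrtr_ge0.
have -> : \sum_(m <= i < n) star ((x + y) i) * (x + y) i =
  (\sum_(m <= i < n) star (x i) * x i + star (\sum_(m <= i < n) star (x i) * y i))
  + (\sum_(m <= i < n) star (x i) * y i + \sum_(m <= i < n) star (y i) * y i).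
  rewrite star_sum -!big_split /=; apply: eq_bigr => i _.
  by rewrite star_mul starK starD mulrDr !mulrDl.
apply: cross_terms_le; rewrite ?sqrtr_ge0// ?bnorm_sq//.
apply: le_sqr; first by rewrite mulr_ge0// sqrtr_ge0.
by rewrite exprMn !bnorm_sq; exact: (gram_cs HA).
Qed.

Lemma bnorm_le m n x : (m <= n)%N -> l2 A x -> bnorm m n x <= N2 x.
Proof.
move=> mn lx; rewrite /bnorm /N2 ler_sqrt ?rn_ge0//.
apply: le_trans (psum_le n lx).
by apply: block_le; rewrite ?leqnn ?mn.
Qed.

Lemma bnorm_tail x (e : R) : l2 A x -> 0 < e ->
  exists N, forall m n, (N <= m <= n)%N -> bnorm m n x <= e.
Proof.
move=> /l2P lx e0; have [|N HN] := lx (e ^+ 2); first by rewrite exprn_gt0.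
exists N => m n Nmn; apply: sqrt_le; first exact: ltW.
by rewrite -psum_sub ?HN//; case/andP: Nmn.
Qed.

Lemma l2_of_bnorm x :
  (forall e : R, 0 < e -> exists N, forall m n, (N <= m <= n)%N -> bnorm m n x <= e) ->
  l2 A x.
Proof.
move=> h; apply/l2P => e e0.
have [|N HN] := h (Num.sqrt e); first by rewrite sqrtr_gt0.
exists N => m n Nmn; rewrite psum_sub; last by case/andP: Nmn.
rewrite -bnorm_sq -[e]sqr_sqrtr ?(ltW e0)//.
by rewrite ler_pXn2r ?nnegrE ?sqrtr_ge0//; exact: HN.
Qed.

Definition l2tends (u : nat -> nat -> A) x : Prop :=
  forall e : R, 0 < e -> exists N, forall n, (N <= n)%N -> N2 (u n - x) <= e.

(** Coordinatewise limits exist because coordinates are bounded by the norm.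
    The estimates on blocks [m, n[ pass to the limit and hold uniformly, which
    shows both that the limit is square summable and that it is a limit in
    norm. *)
Lemma l2_complete (u : nat -> nat -> A) : (forall n, l2 A (u n)) ->
  (forall e : R, 0 < e ->
    exists N, forall m n, (N <= m <= n)%N -> N2 (u n - u m) <= e) ->
  exists2 x, l2 A x & l2tends u x.
Proof.
move=> lu cu.
have /choice[x ux] : forall i, exists l, tends (fun n => u n i) l.
  move=> i; apply: cauchy_tends => e /cu[N HN]; exists N => m n /HN h.
  by apply: le_trans h; apply: (@coord_le (u n - u m) i); exact: l2B.
have dif (e : R) : 0 < e -> exists N, forall k, (N <= k)%N ->
    forall m n, (m <= n)%N -> bnorm m n (u k - x) <= e.
  move=> e0; have [N HN] := cu e e0; exists N => k Nk m n mn.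
  apply: sqrt_le; first exact: ltW.
  have lim : tends (fun p => \sum_(m <= i < n)
      star ((u k - u (p + k)%N) i) * (u k - u (p + k)%N) i)
    (\sum_(m <= i < n) star ((u k - x) i) * (u k - x) i).
    elim: (index_iota m n) => [|i r IH].
      rewrite big_nil; apply: (tends_eq _ (tends_cst 0)) => p.
      by rewrite big_nil.
    rewrite big_cons; have ui : tends (fun p => (u k - u (p + k)%N) i) ((u k - x) i).
      have uk := tends_comp (f := fun p => (p + k)%N) (fun p => leq_addr _ _) (ux i).
      exact: (tendsB (tends_cst (u k i)) uk).
    apply: (tends_eq _ (tendsD (tendsM (tends_star ui) ui) IH)) => p.
    by rewrite big_cons.
  apply: (tends_le _ lim) => p.
  rewrite -bnorm_sq ler_pXn2r ?nnegrE ?sqrtr_ge0 ?(ltW e0)//.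
  rewrite (le_trans (bnorm_le mn _))//; first exact: l2B.
  by rewrite N2BC; apply: HN; rewrite Nk leq_addl.
have lx : l2 A x.
  apply: l2_of_bnorm => e e0.
  have e2 : 0 < e / 2 by rewrite divr_gt0.
  have [K HK] := dif _ e2.
  have [N HN] := bnorm_tail (lu K) e2.
  exists N => m n Nmn.
  have -> : x = u K + (- (u K - x)) by rewrite opprB addrC subrK.
  have := bnormD m n (u K) (- (u K - x)).
  have -> : bnorm m n (- (u K - x)) = bnorm m n (u K - x).
    by congr (Num.sqrt (rn _)); apply: eq_bigr => i _; rewrite -[(- _) i]/(- (_ i)) starN mulrNN.
  have := HK K (leqnn _) m n (proj2 (andP Nmn)); have := HN _ _ Nmn; lra.
exists x => // e e0; have [K HK] := dif e e0; exists K => n Kn.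
apply: sqrt_le; first exact: ltW.
have lux : l2 A (u n - x) by exact: l2B.
apply: (tends_le _ (l2ip_tends lux lux)) => p.
by rewrite -bnorm_sq ler_pXn2r ?nnegrE ?sqrtr_ge0 ?(ltW e0)//; exact: HK.
Qed.

End L2.

(** * The kernel projection as a limit of powers *)

Section SymmetricContraction.
Context (R : realType) (V : lmodType R[i]) (B : V -> V -> R[i]) (tau : V -> V).
Context (HB : psd_form B).
Context (tauL : forall (c : R[i]) x y, tau (c *: x + y) = c *: tau x + tau y).
Context (tauS : forall x y, B (tau x) y = B x (tau y)).
Context (tau0 : forall x, 0 <= B x (tau x)).
Context (C : R).
Context (C0 : 0 < C).
Context (tauC : forall x, complex.Re (B x (tau x)) <= C * complex.Re (B x x)).

(** The operator 1 - tau / C.  For 0 <= tau <= C it is a symmetric contraction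
    that fixes exactly the kernel of tau. *)
Definition relax x := x - (C^-1)%:C *: tau x.

Let b2 x := complex.Re (B x x).
Let q x := complex.Re (B x (tau x)).

Let b2_ge0 x : 0 <= b2 x.
Proof. exact: psd_Re_ge0. Qed.

Let q_psd : psd_form (fun x y => B x (tau y)).
Proof.
split=> [c x y z|x y|//]; first by rewrite tauL (psdDr HB) (psdZr HB).
by rewrite -tauS (psdC HB).
Qed.

(** The operator inequality tau^2 <= C tau. *)
Lemma tau_sq x : b2 (tau x) <= C * q x.
Proof.
have := cauchy_schwarz (tau x) x q_psd; rewrite -/(q x) (psd_real HB) rnC -/(b2 _).
rewrite ger0_norm// => cs.
have q0 : 0 <= q x by have := tau0 x; rewrite lecE => /andP[].
have {cs} := le_trans cs (ler_wpM2r q0 (tauC _)); rewrite -/(b2 _) mulrAC mulrC expr2.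
have [->|h0] := eqVneq (b2 (tau x)) 0; first by rewrite mulr_ge0 ?(ltW C0).
by rewrite ler_pM2l// lt_def h0 b2_ge0.
Qed.

Let qE x : B x (tau x) = (q x)%:C.
Proof. by rewrite /q RRe_real ?ger0_real. Qed.

Lemma relax_le x : b2 (relax x) <= b2 x.
Proof.
have E : b2 (relax x) = b2 x - 2 * C^-1 * q x + C^-1 ^+ 2 * b2 (tau x).
  apply: complexI; rewrite -/(b2 _) /b2 -(psd_real HB) /relax.
  rewrite !(psdBl HB, psdBr HB, psdZl HB, psdZr HB) tauS qE (psd_real HB x).
  rewrite (psd_real HB (tau x)) conjc_real !(rmorphD, rmorphB, rmorphM) /=.
  by ring.
have Ci : 0 < C^-1 by rewrite invr_gt0.
have := ler_wpM2l (ltW Ci) (tau_sq x); rewrite mulKf ?gt_eqF// => h.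
have := ler_wpM2l (ltW Ci) h; rewrite mulrA -expr2.
have q0 : 0 <= C^-1 * q x.
  by rewrite mulr_ge0 ?(ltW Ci)//; have := tau0 x; rewrite lecE => /andP[].
by rewrite E; lra.
Qed.

Lemma relaxS x y : B (relax x) y = B x (relax y).
Proof. by rewrite (psdBl HB) (psdBr HB) (psdZl HB) (psdZr HB) tauS conjc_real. Qed.

Lemma relax_iterS k x y : B (iter k relax x) y = B x (iter k relax y).
Proof.
elim: k x y => //= k IH x y.
by rewrite relaxS IH -iterSr.
Qed.

Lemma relax_iter_decr x m j : b2 (iter (j + m) relax x) <= b2 (iter m relax x).
Proof.
elim: j => // j IH; rewrite addSn /=.
exact: le_trans (relax_le _) IH.
Qed.

(** Only even powers are used: for them each inner product
    <v^(2k) x, v^(2m) x> is the square norm |v^(k+m) x|^2, so that the square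
    of the distance is a combination of terms of a single decreasing
    sequence. *)
Lemma relax_iter_cauchy x m k : (m <= k)%N ->
  b2 (iter k.*2 relax x - iter m.*2 relax x) <=
  b2 (iter m.*2 relax x) - b2 (iter k.*2 relax x).
Proof.
move=> mk; pose a j := b2 (iter j relax x).
have cross i j : (i + j = (m + k).*2)%N ->
    B (iter i relax x) (iter j relax x) = (a (m + k)%N)%:C.
  move=> ij; rewrite /a /b2 -(psd_real HB) !relax_iterS -!iterD.
  by rewrite ij addnn.
have -> : b2 (iter k.*2 relax x - iter m.*2 relax x) =
    a k.*2 + a m.*2 - 2 * a (m + k)%N.
  apply: complexI; rewrite /b2 -(psd_real HB).
  have c1 : (k.*2 + m.*2 = (m + k).*2)%N by rewrite -doubleD addnC.
  have c2 : (m.*2 + k.*2 = (m + k).*2)%N by rewrite -doubleD.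
  rewrite !(psdBl HB, psdBr HB) (cross _ _ c1) (cross _ _ c2).
  rewrite (psd_real HB (iter k.*2 _ _)) (psd_real HB (iter m.*2 _ _)).
  by rewrite -/(a _) -/(a _) !(rmorphD, rmorphB, rmorphM) /=; ring.
have : a k.*2 <= a (m + k)%N.
  rewrite /a -addnn -[X in (X + k)%N](subnK mk) -addnA.
  exact: relax_iter_decr.
rewrite -/(a _) -/(a _); lra.
Qed.

(** With z = tau x / C the hypothesis reads tau z / C = 2 z, whereas tau / C
    has norm at most 1. *)
Lemma relax_fixed x : relax (relax x) = x -> b2 (tau x) = 0.
Proof.
have tauZ c y : tau (c *: y) = c *: tau y.
  have tau00 : tau 0 = 0.
    apply: (addrI (tau 0)); rewrite -{1}(scale1r (tau 0)) -tauL.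
    by rewrite scale1r !addr0.
  by rewrite -[c *: y]addr0 tauL tau00 addr0.
have tauB y z : tau (y - z) = tau y - tau z.
  by rewrite addrC -scaleN1r tauL scaleN1r addrC.
set z := (C^-1)%:C *: tau x.
rewrite /relax -/z tauB scalerBr -/z => h.
have zz : (C^-1)%:C *: tau z = z + z.
  apply: (addrI (x - z - z)); rewrite [RHS]addrA !subrK.
  by move: h; rewrite opprD opprK addrA.
have bz y (c : R) : b2 (c%:C *: y) = c ^+ 2 * b2 y.
  apply: complexI; rewrite /b2 -(psd_real HB) (psdZl HB) (psdZr HB) conjc_real.
  by rewrite (psd_real HB y) !rmorphM /=; ring.
have z0 : b2 z = 0.
  have : b2 (z + z) <= b2 z.
    rewrite -zz bz.
    have h1 := tau_sq z; have h2 := ler_wpM2l (ltW C0) (tauC z).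
    have := le_trans h1 h2; rewrite mulrA -expr2 -/(b2 z) => h3.
    by rewrite exprVn mulrC ler_pdivrMr ?exprn_gt0// mulrC.
  have -> : z + z = 2%:C *: z.
    by rewrite -[2 in RHS]/(1 + 1) rmorphD scalerDl rmorph1 scale1r.
  by rewrite bz; have := b2_ge0 z; lra.
have := bz (tau x) C^-1; rewrite -/z z0 => /esym/eqP.
by rewrite mulf_eq0 sqrf_eq0 invr_eq0 gt_eqF//= => /eqP.
Qed.

Lemma relax_ker x : tau x = 0 -> relax x = x.
Proof. by rewrite /relax => ->; rewrite scaler0 subr0. Qed.

End SymmetricContraction.

(** * Relations among finitely many vectors *)

Lemma linear_pack (K : nzRingType) (U W : lmodType K) (f : U -> W) :
  (forall c x y, f (c *: x + y) = c *: f x + f y) ->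
  exists L : {linear U -> W}, forall x, L x = f x.
Proof.
move=> fl; pose m := GRing.isLinear.Build K U W *:%R f fl.
pose L : {linear U -> W} := HB.pack f m.
by exists L.
Qed.

Lemma contraction_continuous (R : realType) (V W : normedModType R[i]) (f : V -> W) :
  (forall x y, rn (f x - f y) <= rn (x - y)) -> continuous f.
Proof.
move=> fc x; apply/cvgrPdist_le => e e0.
apply: filterS (@cvgr_dist_le _ _ _ (nbhs x) _ id x cvg_id e e0) => y.
by apply: le_trans; rewrite -!rnE lecR.
Qed.

Section Syzygy.
Context (R : realType) (H : completeNormedModType R[i]) (ip : H -> H -> R[i]).
Context (Hip : hilbert_product ip).
Context (A : cstarAlgType R) (HA : is_wstar A) (pi : A -> {linear H -> H}).
Context (Hpi : isometric_representation ip pi).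
Context (Hbi : bicommutant_closed [set (pi a : H -> H) | a in setT]).
Context (n : nat) (t : 'I_n -> nat -> A).
Context (lt : forall j, l2 A (t j)).

Let V := 'I_n -> H.
Let sip (x y : V) : R[i] := \sum_(i < n) ip (x i) (y i).
Let sip_psd : psd_form sip.
Proof. exact: sum_ip_psd. Qed.
Let tau (x : V) : V := fun i => \sum_(j < n) pi (l2ip (t i) (t j)) (x j).
Let b2 x := complex.Re (sip x x).

Let b2E x : b2 x = \sum_(i < n) rn (x i) ^+ 2.
Proof.
apply: complexI; rewrite -(psd_real sip_psd) /sip rmorph_sum /=.
by apply: eq_bigr => i _; rewrite (ip_norm Hip).
Qed.

Let coord_b2 x i : rn (x i) ^+ 2 <= b2 x.
Proof.
rewrite b2E (bigD1 i)//= lerDl; apply: sumr_ge0 => j _.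
by rewrite exprn_ge0// rn_ge0.
Qed.

Let tau_lin (c : R[i]) x y : tau (c *: x + y) = c *: tau x + tau y.
Proof.
apply/funext => i; rewrite -[RHS]/(c *: tau x i + tau y i).
rewrite scaler_sumr -big_split /=; apply: eq_bigr => j _.
by rewrite -[(c *: x + y) j]/(c *: x j + y j) linearP.
Qed.

Let tau_sym x y : sip (tau x) y = sip x (tau y).
Proof.
rewrite /sip; under eq_bigr do rewrite (psd_suml (ip_psd Hip)).
rewrite exchange_big /=; apply: eq_bigr => j _.
rewrite (psd_sumr (ip_psd Hip)); apply: eq_bigr => i _.
by rewrite (rep_star Hpi) l2ip_star.
Qed.

(** The quadratic form of the Gram matrix is the sum of a series of squares,
    which dominates its partial sums; hence a vector annihilated by the matrix
    satisfies each coordinate of the relation. *)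
Lemma gram_quad_ge (x : V) p :
  (\sum_(0 <= m < p) rn (\sum_(j < n) pi (t j m) (x j)) ^+ 2)%:C <= sip x (tau x).
Proof.
pose f p : R[i] := (\sum_(0 <= m < p) rn (\sum_(j < n) pi (t j m) (x j)) ^+ 2)%:C.
have fE k : f k = \sum_(i < n) \sum_(j < n) ip (x i) (pi (psum (t i) (t j) k) (x j)).
  rewrite /f rmorph_sum /=.
  under [RHS]eq_bigr do under eq_bigr do rewrite (ip_gram Hip Hpi).
  under [RHS]eq_bigr do rewrite exchange_big /=.
  rewrite exchange_big /=; apply: eq_bigr => m _.
  rewrite -(ip_norm Hip) (psd_suml (ip_psd Hip)); apply: eq_bigr => i _.
  by rewrite (psd_sumr (ip_psd Hip)).
have flim : tends (f : nat -> R[i]^o) (sip x (tau x)).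
  have E : sip x (tau x) =
      \sum_(i < n) \sum_(j < n) ip (x i) (pi (l2ip (t i) (t j)) (x j)).
    by apply: eq_bigr => i _; rewrite (psd_sumr (ip_psd Hip)).
  rewrite E; apply: (@tends_eq R R[i]^o _ f _ (fun k => esym (fE k))).
  apply: (@tends_sum R R[i]^o) => i; apply: (@tends_sum R R[i]^o) => j.
  have h := @tends_map R A R[i]^o (fun a => ip (x i) (pi a (x j)))
     (rn (x i) * rn (x j)) (psum (t i) (t j)) (l2ip (t i) (t j)).
  apply: h; last exact: l2ip_tends.
  - by move=> a b; rewrite (repB Hpi) (psdBr (ip_psd Hip)).
  - move=> a; apply: (le_trans (ip_cs Hip _ _)).
    rewrite -mulrA ler_wpM2l ?rn_ge0// mulrC; exact: rep_le Hpi _ _.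
apply: (tends_geC (N := p) _ flim) => k pk.
rewrite lecR [X in _ <= X](big_cat_nat (n := p))//= lerDl; apply: sumr_ge0 => m _.
by rewrite exprn_ge0// rn_ge0.
Qed.

Let tau_ge0 x : 0 <= sip x (tau x).
Proof. by apply: le_trans (gram_quad_ge x 0); rewrite big_nil. Qed.

Let C : R := 1 + \sum_(i < n) \sum_(j < n) rn (l2ip (t i) (t j)).

Let C_gt0 : 0 < C.
Proof. by rewrite ltr_pwDl// sumr_ge0// => i _; rewrite sumr_ge0// => j _; rewrite rn_ge0. Qed.

Let tau_bound x : complex.Re (sip x (tau x)) <= C * complex.Re (sip x x).
Proof.
apply: (@le_trans _ _ (rn (sip x (tau x)))).
  by rewrite -lecR rnE (le_trans _ (normc_ge_Re _))// lecR ler_norm.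
rewrite -/(b2 x) mulrDl mul1r (le_trans (rn_sum _ _ _))//.
rewrite -[X in X <= _]add0r lerD ?psd_Re_ge0// mulr_suml; apply: ler_sum => i _.
rewrite (psd_sumr (ip_psd Hip)) (le_trans (rn_sum _ _ _))// mulr_suml.
apply: ler_sum => j _; rewrite (le_trans (ip_cs Hip _ _))//.
have h : rn (x i) * rn (x j) <= b2 x.
  have := coord_b2 x i; have := coord_b2 x j; have := sqr_ge0 (rn (x i) - rn (x j)).
  nra.
apply: (le_trans (ler_wpM2l (rn_ge0 _) (rep_le Hpi _ _))).
by rewrite mulrCA ler_wpM2l ?rn_ge0.
Qed.

Let v := relax tau C.
Let w k (x : V) : V := iter k.*2 v x.

Let v_lin (c : R[i]) x y : v (c *: x + y) = c *: v x + v y.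
Proof.
rewrite /v /relax tau_lin scalerBr scalerDr opprD addrACA.
by rewrite !scalerA [c * _]mulrC.
Qed.

Let w_lin k (c : R[i]) x y : w k (c *: x + y) = c *: w k x + w k y.
Proof.
rewrite /w; elim: k.*2 => //= m ->; exact: v_lin.
Qed.

Let w_le k x : b2 (w k x) <= b2 x.
Proof.
have := relax_iter_decr sip_psd tau_lin tau_sym tau_ge0 C_gt0 tau_bound x 0 k.*2.
by rewrite addn0.
Qed.

Let w_tends x i : exists l, tends (fun k => w k x i) l.
Proof.
apply: cauchy_tends => e e0.
have ic := relax_iter_cauchy sip_psd tau_lin tau_sym tau_ge0 C_gt0 tau_bound x.
have wS k : - b2 (w k x) <= - b2 (w k.+1 x).
  rewrite lerN2.
  have h := relax_iter_decr sip_psd tau_lin tau_sym tau_ge0 C_gt0 tau_bound x k.*2 2.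
  exact: h.
have w0 k : - b2 (w k x) <= 0 by rewrite oppr_le0 psd_Re_ge0.
have [|N HN] := nondecr_cauchy wS w0 (e := e ^+ 2); first by rewrite exprn_gt0.
exists N => m k Nmk; apply: le_sqr; first exact: ltW.
apply: le_trans (HN _ _ Nmk); rewrite opprK [leRHS]addrC.
apply: le_trans (ic _ _ (proj2 (andP Nmk))).
exact: (coord_b2 (w k x - w m x)).
Qed.

(** The strong limit E of the even powers of 1 - tau / C, which is the
    projection onto the kernel of the Gram matrix. *)
Lemma kernel_projection : exists E : V -> V, forall x i, tends (fun k => w k x i) (E x i).
Proof.
have /choice[E HE] : forall xi : V * 'I_n, exists l, tends (fun k => w k xi.1 xi.2) l.
  by move=> [x i]; exact: w_tends.
by exists (fun x i => E (x, i)) => x i; exact: (HE (x, i)).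
Qed.

Lemma syzygy_rep : exists a : 'I_n -> 'I_n -> A,
  (forall k, \sum_(j < n) ract (t j) (a j k) = 0) /\
  forall c : 'I_n -> A, \sum_(j < n) ract (t j) (c j) = 0 ->
    forall i, c i = \sum_(k < n) a i k * c k.
Proof.
have [E HE] := kernel_projection.
have E_lin (c : R[i]) x y i : E (c *: x + y) i = c *: E x i + E y i.
  apply: (tends_unique (HE _ i)).
  apply: (tends_eq _ (tendsD (tendsZ c (HE x i)) (HE y i))) => k.
  by rewrite w_lin.
have E_le x i : rn (E x i) ^+ 2 <= b2 x.
  have b0 : 0 <= b2 x by exact: psd_Re_ge0.
  rewrite -[b2 x]sqr_sqrtr// ler_pXn2r ?nnegrE ?rn_ge0 ?sqrtr_ge0//.
  apply: (tends_le _ (HE x i)) => k; apply: le_sqr; first exact: sqrtr_ge0.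
  by rewrite sqr_sqrtr// (le_trans (coord_b2 _ _) (w_le _ _)).
have E_ker x : tau x = 0 -> E x = x.
  move=> /(relax_ker C) vx; apply/funext => i; apply: (tends_unique (HE x i)).
  have wx k : w k x = x by rewrite /w; elim: k.*2 => //= m ->; exact: vx.
  by apply: (tends_eq _ (tends_cst _)) => k; rewrite wx.
have v_tends (u : nat -> V) l : (forall i, tends (fun k => u k i) (l i)) ->
    forall i, tends (fun k => v (u k) i) (v l i).
  move=> ul i; apply: tendsB; first exact: ul.
  apply: tendsZ; apply: tends_sum => j.
  have h := @tends_map R H H (pi (l2ip (t i) (t j))) (rn (l2ip (t i) (t j)))
    (fun k => u k j) (l j).
  apply: h; [exact: raddfB|exact: rep_le Hpi _|exact: ul].
have E_tau x m : \sum_(j < n) pi (t j m) (E x j) = 0.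
  have vvE : v (v (E x)) = E x.
    apply/funext => i; apply: (tends_unique (v_tends _ _ (v_tends _ _ (HE x)) i)).
    have := tends_comp (f := succn) (fun k => leqnSn k) (HE x i).
    exact: tends_eq.
  have b0 := relax_fixed sip_psd tau_lin tau_sym tau_ge0 C_gt0 tau_bound vvE.
  have tE i : tau (E x) i = 0.
    apply: rn_eq0; apply/eqP; rewrite -sqrf_eq0 eq_le sqr_ge0 andbT.
    by rewrite -b0; exact: coord_b2.
  have := gram_quad_ge (E x) m.+1.
  have -> : sip (E x) (tau (E x)) = (0 : R)%:C.
    by rewrite /sip big1// => i _; rewrite tE (psd0r (ip_psd Hip)).
  rewrite lecR big_nat_recr//= => h.
  apply: rn_eq0; apply/eqP; rewrite -sqrf_eq0 eq_le sqr_ge0 andbT.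
  apply: le_trans h; rewrite lerDr; apply: sumr_ge0 => k _.
  by rewrite exprn_ge0// rn_ge0.
have E_comm (S : {linear H -> H}) : continuous S ->
    (forall a h, S (pi a h) = pi a (S h)) ->
    forall x i, E (fun j => S (x j)) i = S (E x i).
  move=> cS Spi x i; apply: (tends_unique (HE _ i)).
  have vS y : v (fun j => S (y j)) = (fun j => S (v y j)).
    apply/funext => j; rewrite /v /relax.
    rewrite -[LHS]/(S (y j) - (C^-1)%:C *: tau (fun j => S (y j)) j).
    rewrite -[(y - _) j]/(y j - (C^-1)%:C *: tau y j) raddfB; congr (_ - _).
    rewrite [RHS]linearZZ; congr (_ *: _); rewrite raddf_sum; apply: eq_bigr => k _.
    exact: esym (Spi _ _).
  have wS k y : w k (fun j => S (y j)) = (fun j => S (w k y j)).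
    by rewrite /w; elim: k.*2 => //= m ->; rewrite vS.
  apply: (@tends_eq _ _ (fun k => S (w k x i))) => [k|]; first by rewrite wS.
  apply/tendsP; apply: continuous_cvg; first exact: cS.
  exact/tendsP/HE.
pose delta j (h : H) : V := fun i => if i == j then h else 0.
have delta_lin j (c : R[i]) g h : delta j (c *: g + h) = c *: delta j g + delta j h.
  apply/funext => i; rewrite -[RHS]/(c *: delta j g i + delta j h i) /delta.
  by case: ifP => // _; rewrite scaler0 addr0.
have b2_delta j h : b2 (delta j h) = rn h ^+ 2.
  rewrite b2E (bigD1 j)//= /delta eqxx big1 ?addr0// => i /negbTE ->.
  by rewrite rn0 expr0n.
have /choice[a Ha] : forall ij : 'I_n * 'I_n, exists b,
    forall h, pi b h = E (delta ij.2 h) ij.1.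
  move=> [i j] /=.
  have [L LE] := @linear_pack _ H H (fun h => E (delta j h) i)
    (fun c g h => etrans (congr1 (fun z => E z i) (delta_lin j c g h)) (E_lin _ _ _ _)).
  have Lc : continuous L.
    apply: contraction_continuous => g h; rewrite -(linearB L) LE.
    by apply: le_sqr; rewrite ?rn_ge0// -[leRHS](b2_delta j); exact: E_le.
  have [|b _ bL] := Hbi Lc; last by exists b => h; rewrite -LE -bL.
  move=> S cS Scomm h; rewrite /= !LE.
  rewrite -E_comm// => [|b g]; last by have := Scomm _ (ex_intro2 _ _ b I erefl) g.
  congr (E _ i); apply/funext => k; rewrite /delta.
  by case: ifP => // _; rewrite raddf0.
exists (fun i j => a (i, j)); split=> [k|c c0 i].
  apply/funext => m; rewrite fct_sumE; apply: (rep_faithful Hpi) => h.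
  rewrite (rep_sum Hpi) (rep0 Hpi) -[RHS](E_tau (delta k h) m).
  by apply: eq_bigr => j _; rewrite (repM Hpi) Ha.
apply: (rep_faithful Hpi) => h; rewrite (rep_sum Hpi).
pose x : V := fun j => pi (c j) h.
have xE : x = \sum_(k < n) delta k (x k).
  apply/funext => j; rewrite fct_sumE (bigD1 j)//= /delta eqxx big1 ?addr0// => k.
  by rewrite eq_sym => /negbTE ->.
have Esum (r : seq 'I_n) (f : 'I_n -> V) : E (\sum_(k <- r) f k) i = \sum_(k <- r) E (f k) i.
  have ED y z : E (y + z) i = E y i + E z i.
    by rewrite -{1}[y]scale1r E_lin scale1r.
  have E0 : E 0 i = 0 by apply: (addrI (E 0 i)); rewrite -ED !addr0.
  exact: (big_morph _ ED E0).
have tx : tau x = 0.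
  apply/funext => j; rewrite /tau /x.
  under eq_bigr do rewrite -(repM Hpi).
  rewrite -(rep_sum Hpi); under eq_bigr do rewrite -l2ip_ractr//.
  rewrite -l2ip_sumr// ?c0 ?l2ip0r ?(rep0 Hpi)// => k; exact: l2_ract.
rewrite -[LHS]/(x i) -(E_ker _ tx) {1}xE Esum; apply: eq_bigr => k _.
by rewrite (repM Hpi) Ha.
Qed.

End Syzygy.

Lemma syzygy_finitely_generated (R : realType) (A : cstarAlgType R) (HA : is_wstar A)
  (n : nat) (t : 'I_n -> nat -> A) : (forall j, l2 A (t j)) ->
  exists a : 'I_n -> 'I_n -> A,
  (forall k, \sum_(j < n) ract (t j) (a j k) = 0) /\
  forall c : 'I_n -> A, \sum_(j < n) ract (t j) (c j) = 0 ->
    forall i, c i = \sum_(k < n) a i k * c k.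
Proof.
move=> lt; have [H [ip [pi [Hip Hpi Hbi]]]] := HA.
exact: (@syzygy_rep R H ip Hip A HA pi Hpi Hbi n t lt).
Qed.

(** * Tails *)

Section Tails.
Context (R : realType) (A : cstarAlgType R) (HA : is_wstar A).
Implicit Types (x y z : nat -> A).

Definition tailp n x : nat -> A := fun i => if (n <= i)%N then x i else 0.

Lemma tailpZD n (c : R[i]) x y : tailp n (c *: x + y) = c *: tailp n x + tailp n y.
Proof.
apply/funext => i; rewrite -[RHS]/(c *: tailp n x i + tailp n y i) /tailp.
by case: ifP => // _; rewrite scaler0 addr0.
Qed.
Lemma tailpB n x y : tailp n (x - y) = tailp n x - tailp n y.
Proof.
apply/funext => i; rewrite -[RHS]/(tailp n x i - tailp n y i) /tailp.
by case: ifP => // _; rewrite subr0.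
Qed.
Lemma tailp0 n : tailp n 0 = 0.
Proof. by apply/funext => i; rewrite /tailp if_same. Qed.
Lemma tailp_ract n x a : tailp n (ract x a) = ract (tailp n x) a.
Proof.
by apply/funext => i; rewrite /tailp /ract; case: ifP => //; rewrite mul0r.
Qed.
Lemma tailpK m n x : (m <= n)%N -> tailp m (tailp n x) = tailp n x.
Proof.
move=> mn; apply/funext => i; rewrite /tailp; case: ifP => // /negbT.
by rewrite -ltnNge => im; rewrite leqNgt (leq_trans im).
Qed.
Lemma tailpK' m n x : (m <= n)%N -> tailp n (tailp m x) = tailp n x.
Proof.
by move=> mn; apply/funext => i; rewrite /tailp; case: ifP => // /(leq_trans mn) ->.
Qed.
Lemma tailp_fix m n x : (m <= n)%N -> tailp n x = x -> tailp m x = x.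
Proof. by move=> mn <-; exact: tailpK. Qed.

Lemma psum_tailr n x y p : psum x (tailp n y) p = \sum_(n <= i < p) star (x i) * y i.
Proof.
have [np|/ltnW pn] := leqP n p.
  rewrite /psum (big_cat_nat (n := n))//= big_nat_cond big1 ?add0r.
    by apply: eq_big_nat => i /andP[ni _]; rewrite /tailp ni.
  by move=> i /andP[/andP[_ iln] _]; rewrite /tailp leqNgt iln mulr0.
rewrite [RHS]big_geq// /psum big_nat_cond big1// => i /andP[/andP[_ ip] _].
by rewrite /tailp leqNgt (leq_trans ip pn) mulr0.
Qed.
Lemma psum_taill n x y p : psum (tailp n x) y p = \sum_(n <= i < p) star (x i) * y i.
Proof.
rewrite -psum_star psum_tailr star_sum; apply: eq_bigr => i _.
by rewrite star_mul starK.
Qed.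
Lemma psum_tail n x y p : psum (tailp n x) (tailp n y) p = \sum_(n <= i < p) star (x i) * y i.
Proof.
rewrite psum_taill; apply: eq_big_nat => i /andP[ni _]; by rewrite /tailp ni.
Qed.

Lemma l2ip_tail n x y : l2ip (tailp n x) y = l2ip x (tailp n y).
Proof.
congr (limn _); apply/funext => p.
exact: etrans (psum_taill n x y p) (esym (psum_tailr n x y p)).
Qed.
Lemma l2_tail n x : l2 A x -> l2 A (tailp n x).
Proof.
move=> /l2P lx; apply/l2P => e /lx[N HN]; exists (maxn N n) => m p.
rewrite geq_max => /andP[/andP[Nm nm] mp].
rewrite !psum_tail -!psum_taill psum_sub// (_ : \sum_(_ <= _ < _) _ = psum x x p - psum x x m).
  by rewrite HN ?Nm.
rewrite psum_sub//; apply: eq_big_nat => i /andP[mi _].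
by rewrite /tailp (leq_trans nm mi).
Qed.

Lemma N2_tail_bnorm n x (e : R) : l2 A x -> 0 <= e ->
  (forall p, (n <= p)%N -> bnorm n p x <= e) -> N2 (tailp n x) <= e.
Proof.
move=> lx e0 H; apply: sqrt_le => //.
have lt := l2_tail (n := n) lx; apply: (tends_le _ (l2ip_tends HA lt lt)) => p.
rewrite psum_tail; have [np|/ltnW pn] := leqP n p.
  by rewrite -bnorm_sq ler_pXn2r ?nnegrE ?sqrtr_ge0//; exact: H.
by rewrite big_geq// rn0 exprn_ge0.
Qed.

Lemma N2_tail_le n x : l2 A x -> N2 (tailp n x) <= N2 x.
Proof.
by move=> lx; apply: N2_tail_bnorm => [//||p np]; [exact: N2_ge0|exact: bnorm_le].
Qed.

Lemma N2_tail_small x (e : R) : l2 A x -> 0 < e ->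
  exists N, forall n, (N <= n)%N -> N2 (tailp n x) <= e.
Proof.
move=> lx e0; have [N HN] := bnorm_tail lx e0; exists N => n Nn.
by apply: N2_tail_bnorm; rewrite ?(ltW e0)// => p np; apply: HN; rewrite Nn.
Qed.

Definition ebasis j : nat -> A := fun i => if i == j then 1 else 0.

Lemma l2_finsupp n x : tailp n x = 0 -> l2 A x.
Proof.
move=> tx; apply: (@l2_of_tends _ _ _ (psum x x n)) => e e0.
exists n => p np; rewrite psum_sub//.
have x0 i : (n <= i)%N -> x i = 0.
  by move=> ni; have := congr1 (fun f => f i) tx; rewrite /tailp ni.
by rewrite big_nat big1 ?rn0 ?ltW// => i /andP[/x0 -> _]; rewrite mulr0.
Qed.

Lemma l2_ebasis j : l2 A (ebasis j).
Proof.
apply: (@l2_finsupp j.+1); apply/funext => i; rewrite /tailp /ebasis.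
by case: ifP => // ji; rewrite gtn_eqF.
Qed.

Lemma tailp_ebasis n j : (j < n)%N -> tailp n (ebasis j) = 0.
Proof.
move=> jn; apply/funext => i; rewrite /tailp /ebasis; case: ifP => // ni.
by rewrite gtn_eqF// (leq_trans jn).
Qed.

Lemma head_sum n x : x - tailp n x = \sum_(j < n) ract (ebasis j) (x j).
Proof.
apply/funext => i; rewrite fct_sumE -[LHS]/(x i - tailp n x i) /tailp.
have [ni|iltn] := leqP n i.
  rewrite subrr big1// => j _; rewrite /ract /ebasis gtn_eqF ?mul0r//.
  exact: leq_trans ni.
rewrite subr0 (bigD1 (Ordinal iltn))//= /ract /ebasis eqxx mul1r big1 ?addr0//.
move=> j /negP ji; rewrite ifF ?mul0r//; apply/negbTE/negP => /eqP ij.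
by apply: ji; apply/eqP/val_inj.
Qed.

End Tails.

(** * Bounded operators and uniform boundedness *)

Section Operators.
Context (R : realType) (A : cstarAlgType R) (HA : is_wstar A).
Implicit Types (x y z : nat -> A) (F : (nat -> A) -> nat -> A).

Definition blop F : Prop := bounded_Alinear (l2 A) (l2 A) F.

Section Theory.
Context (F : (nat -> A) -> nat -> A) (HF : blop F).

Lemma blop_l2 x : l2 A x -> l2 A (F x).
Proof. by case: HF => h _ _ _; exact: h. Qed.
Lemma blopZD (c : R[i]) x y : l2 A x -> l2 A y -> F (c *: x + y) = c *: F x + F y.
Proof. by case: HF => _ h _ _; exact: h. Qed.
Lemma blop_ract x a : l2 A x -> F (ract x a) = ract (F x) a.
Proof. by case: HF => _ _ h _; exact: h. Qed.
Lemma blopD x y : l2 A x -> l2 A y -> F (x + y) = F x + F y.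
Proof. by move=> lx ly; rewrite -[x]scale1r blopZD// !scale1r. Qed.
Lemma blop0 : F 0 = 0.
Proof.
apply: (addrI (F 0)); rewrite -blopD ?addr0//; exact: l2_0.
Qed.
Lemma blopZ (c : R[i]) x : l2 A x -> F (c *: x) = c *: F x.
Proof.
by move=> lx; rewrite -[c *: x]addr0 blopZD ?blop0 ?addr0//; exact: l2_0.
Qed.
Lemma blopN x : l2 A x -> F (- x) = - F x.
Proof. by move=> lx; rewrite -scaleN1r blopZ// scaleN1r. Qed.
Lemma blopB x y : l2 A x -> l2 A y -> F (x - y) = F x - F y.
Proof. by move=> lx ly; rewrite blopD ?blopN//; exact: l2N. Qed.
Lemma blop_sum I (r : seq I) (f : I -> nat -> A) : (forall i, l2 A (f i)) ->
  F (\sum_(i <- r) f i) = \sum_(i <- r) F (f i).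
Proof.
move=> lf; elim: r => [|i r IH]; first by rewrite !big_nil blop0.
by rewrite !big_cons blopD ?IH//; exact: l2_sum.
Qed.
Lemma blop_bound : exists2 C : R, 0 < C & forall x, l2 A x -> N2 (F x) <= C * N2 x.
Proof.
case: HF => _ _ _ [r Hr]; exists (rn r + 1); first by rewrite ltr_wpDl ?rn_ge0.
move=> x lx; have := Hr x lx; rewrite !l2normE => h.
have : `|(N2 (F x))%:C : R[i]| <= `|r * (N2 x)%:C|.
  by rewrite ger0_norm ?ler0c ?N2_ge0// (le_trans h)// real_ler_norm// ger0_real//
    (le_trans _ h)// ler0c N2_ge0.
rewrite rn_le rnMc !rnC !ger0_norm ?N2_ge0// => /le_trans; apply.
by rewrite ler_wpM2r ?N2_ge0// lerDl.
Qed.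

End Theory.

Lemma blop_of (F : (nat -> A) -> nat -> A) (C : R) :
  (forall x, l2 A x -> l2 A (F x)) ->
  (forall (c : R[i]) x y, l2 A x -> l2 A y -> F (c *: x + y) = c *: F x + F y) ->
  (forall x a, l2 A x -> F (ract x a) = ract (F x) a) ->
  (forall x, l2 A x -> N2 (F x) <= C * N2 x) -> blop F.
Proof.
move=> h1 h2 h3 h4; split=> //; exists C%:C => x lx.
by rewrite !l2normE -rmorphM lecR; exact: h4.
Qed.

Lemma exp_small (q e : R) : 0 <= q < 1 -> 0 < e -> exists k, q ^+ k <= e.
Proof.
move=> /andP[q0 q1] e0.
have /cvgrPdist_le/(_ _ e0)[N _ /(_ N (leqnn N))] : (fun n => q ^+ n) @ \oo --> (0 : R).
  by apply: cvg_expr; rewrite ger0_norm.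
by rewrite /= sub0r normrN ger0_norm ?exprn_ge0// => h; exists N.
Qed.

Lemma geometric_limit (u : nat -> nat -> A) (C q : R) : 0 <= C -> 0 <= q < 1 ->
  (forall k, l2 A (u k)) -> (forall k, N2 (u k.+1 - u k) <= C * q ^+ k) ->
  exists2 x, l2 A x & forall k, N2 (u k - x) <= C / (1 - q) * q ^+ k.
Proof.
move=> C0 /andP[q0 q1] lu Hu; have q1' : 0 < 1 - q by rewrite subr_gt0.
pose D := C / (1 - q); have D0 : 0 <= D by rewrite divr_ge0// ltW.
have DC : C = D - D * q by rewrite -{1}[D]mulr1 -mulrBr divfK ?gt_eqF.
have dist k j : N2 (u (k + j)%N - u k) <= D * q ^+ k - D * q ^+ (k + j).
  elim: j => [|j IH]; first by rewrite addn0 !subrr N20.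
  have h := Hu (k + j)%N.
  have := N2D HA (l2B HA (lu (k + j).+1) (lu (k + j)%N)) (l2B HA (lu (k + j)%N) (lu k)).
  rewrite addrA subrK addnS => /le_trans; apply.
  apply: (le_trans (lerD h IH)); rewrite exprS DC; lra.
have dist' k j : N2 (u (k + j)%N - u k) <= D * q ^+ k.
  apply: (le_trans (dist k j)); rewrite gerBl mulr_ge0// exprn_ge0//.
have [|x lx ux] := l2_complete HA lu.
  move=> e e0; have D1 : 0 < D + 1 by rewrite ltr_wpDl.
  have [|N HN] := @exp_small q (e / (D + 1)) _ (divr_gt0 e0 D1); first by rewrite q0.
  exists N => m n /andP[Nm /subnKC <-]; apply: (le_trans (dist' _ _)).
  apply: (@le_trans _ _ ((D + 1) * q ^+ N)).
    rewrite ler_pM ?exprn_ge0 ?lerDl// ler_wiXn2l// ltW//.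
  by rewrite mulrC -ler_pdivlMr.
exists x => // k; apply/ler_addgt0Pr => e /ux[N HN].
have := N2D HA (l2B HA (lu k) (lu (k + N)%N)) (l2B HA (lu (k + N)%N) lx).
rewrite addrA subrK => /le_trans; apply; apply: lerD; last exact: HN (leq_addl _ _).
by rewrite N2BC; exact: dist'.
Qed.

Lemma closed_limit (M : set (nat -> A)) (u : nat -> nat -> A) x (C q : R) :
  closed_submodule M -> 0 <= C -> 0 <= q < 1 ->
  l2 A x -> (forall k, M (u k)) -> (forall k, N2 (u k - x) <= C * q ^+ k) -> M x.
Proof.
move=> [_ _ _ _ cM] C0 q01 lx Mu ux; apply: cM => // e e0.
have eE : e = (complex.Re e)%:C by rewrite RRe_real ?gtr0_real.
have e0' : 0 < complex.Re e / 2 by rewrite divr_gt0// -ltcR -eE.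
have C1 : 0 < C + 1 by rewrite ltr_wpDl.
have [k Hk] := exp_small q01 (divr_gt0 e0' C1).
exists (u k) => //; rewrite l2normE eE ltcR N2BC (le_lt_trans (ux k))//.
have : (C + 1) * q ^+ k <= complex.Re e / 2 by rewrite mulrC -ler_pdivlMr.
have : C * q ^+ k <= (C + 1) * q ^+ k.
  by rewrite ler_wpM2r ?lerDl// exprn_ge0//; case/andP: q01.
lra.
Qed.

Lemma closed_submoduleZ (M : set (nat -> A)) (c : R[i]) x :
  closed_submodule M -> M x -> M (c *: x).
Proof. by move=> [_ M0 ML _ _] Mx; rewrite -[c *: x]addr0; exact: ML. Qed.

(** The principle of uniform boundedness for the functionals y |-> <y, z> on M,
    by a gliding hump.  If the estimate failed there would be unit vectors y_k
    with w(y_k) <= 4^-k.  Build z by adding in succession the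
    terms 3^-k y_k, each with a sign that keeps |<y_k, z>| at least 3^-k; the terms
    that follow decrease this by at most 3^-k / 2.  In the limit
    |<y_k, z>| >= 3^-k / 2, which is not O(4^-k). *)
Lemma uniform_lower_bound (M : set (nat -> A)) (w : (nat -> A) -> R) :
  closed_submodule M ->
  (forall y, M y -> 0 <= w y) ->
  (forall (s : R) y, M y -> 0 <= s -> w (s%:C *: y) = s * w y) ->
  (forall z, M z -> exists b : R, forall y, M y -> rn (l2ip y z) <= b * w y) ->
  exists2 c : R, 0 < c & forall y, M y -> c * N2 y <= w y.
Proof.
move=> cM w_ge0 wZ wb; have [Ml2 M0 ML _ _] := cM.
apply: contrapT => noc.
have bad (k : nat) : exists y, [/\ M y, N2 y = 1 & w y <= 4^-1 ^+ k].
  have ck : 0 < (4^-1 : R) ^+ k by rewrite exprn_gt0// invr_gt0.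
  have [y [My wy]] : exists y, M y /\ w y < 4^-1 ^+ k * N2 y.
    apply: contrapT => H; apply: noc; exists (4^-1 ^+ k) => // y My.
    by rewrite leNgt; apply/negP => hy; apply: H; exists y.
  have y0 : 0 < N2 y.
    rewrite lt_def N2_ge0 andbT; apply/eqP => Ny; move: wy.
    rewrite Ny mulr0 (N2_eq0 HA (Ml2 _ My) Ny) -[0](scale0r 0) -[0 : R[i]](rmorph0 (real_complex R)).
    by rewrite wZ// mul0r ltxx.
  exists ((N2 y)^-1%:C *: y); split.
  - exact: closed_submoduleZ.
  - by rewrite N2Z// ?rnC ?ger0_norm ?invr_ge0 ?N2_ge0 ?mulVf ?gt_eqF//; exact: Ml2.
  - rewrite wZ ?invr_ge0 ?N2_ge0// mulrC ler_pdivrMr//; exact: ltW.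
have /choice[y Hy] := bad.
pose st k x := (3^-1 ^+ k)%:C *: y k.
pose step k x := if 3^-1 ^+ k <= rn (l2ip (y k) (x + st k x)) then x + st k x else x - st k x.
pose x := fix x k := if k is k'.+1 then step k' (x k') else 0.
have yM k : M (y k) by case: (Hy k).
have yl k : l2 A (y k) by apply: Ml2.
have Mst k z : M (st k z) by exact: closed_submoduleZ.
have lst k z : l2 A (st k z) by exact: Ml2.
have p3 k : 0 <= (3^-1 : R) ^+ k by rewrite exprn_ge0// invr_ge0.
have Nst k z : N2 (st k z) = 3^-1 ^+ k.
  by rewrite N2Z// rnC ger0_norm//; have [_ -> _] := Hy k; rewrite mulr1.
have xM k : M (x k).
  elim: k => [//|k IH]; rewrite /= /step; case: ifP => _.
    by rewrite addrC /st; apply: ML.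
  by rewrite addrC /st -scaleNr; apply: ML.
have xl k : l2 A (x k) by apply: Ml2.
have xS k : N2 (x k.+1 - x k) <= 1 * 3^-1 ^+ k.
  rewrite mul1r /= /step; case: ifP => _; rewrite addrAC subrr add0r ?N2N Nst//.
(* One of the two signs works because the two values differ by
   2 * 3^-k <y_k, y_k>. *)
have big k : 3^-1 ^+ k <= rn (l2ip (y k) (x k.+1)).
  rewrite /= /step; case: ifP => // /negbT; rewrite -ltNge => h.
  have h2 : rn (l2ip (y k) (st k (x k))) = 3^-1 ^+ k.
    rewrite l2ipZr// rnZ rnC ger0_norm// -N2_sq.
    by have [_ -> _] := Hy k; rewrite expr1n mulr1.
  move: h; rewrite l2ipDr// l2ipBr//.
  have := rnB (l2ip (y k) (x k) + l2ip (y k) (st k (x k))) (l2ip (y k) (x k) - l2ip (y k) (st k (x k))).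
  rewrite opprB addrAC addrCA subrr addr0.
  have -> : l2ip (y k) (st k (x k)) + l2ip (y k) (st k (x k)) = 2%:C *: l2ip (y k) (st k (x k)).
    by rewrite -[2 in RHS]/(1 + 1) rmorphD scalerDl rmorph1 scale1r.
  rewrite rnZ rnC h2 ger0_norm//; lra.
have q01 : 0 <= (3^-1 : R) < 1 by lra.
have [z lz xz] := geometric_limit ler01 q01 xl xS.
have Mz : M z by apply: (closed_limit cM _ q01 lz xM xz); rewrite divr_ge0//; lra.
have [b Hb] := wb z Mz.
have key k : 3^-1 ^+ k / 2 <= `|b| * 4^-1 ^+ k.
  have h1 : rn (l2ip (y k) z) <= `|b| * 4^-1 ^+ k.
    have [_ _ wk] := Hy k; apply: (le_trans (Hb _ (yM k))).
    by rewrite (le_trans (ler_wpM2r (w_ge0 _ (yM k)) (ler_norm b)))// ler_wpM2l.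
  have lxz : l2 A (x k.+1 - z) by apply: l2B.
  have h2 : rn (l2ip (y k) (x k.+1 - z)) <= 3^-1 ^+ k / 2.
    rewrite (le_trans (l2ip_cs HA (yl k) lxz))//.
    have [_ -> _] := Hy k; rewrite mul1r (le_trans (xz _))// exprS.
    have -> : 1 / (1 - 3^-1) = 3 / 2 :> R by field.
    lra.
  have := rnD (l2ip (y k) z) (l2ip (y k) (x k.+1 - z)).
  rewrite -(l2ipDr HA (yl k) lz lxz).
  rewrite addrCA subrr addr0; have := big k; lra.
have [||k Hk] := @exp_small (3 / 4) ((4 * (`|b| + 1))^-1).
- by lra.
- by rewrite invr_gt0 mulr_gt0// ltr_wpDl.
have := key k; have -> : (4^-1 : R) ^+ k = (3 / 4) ^+ k * 3^-1 ^+ k.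
  by rewrite -exprMn; congr (_ ^+ _); field.
have p3k : 0 < (3^-1 : R) ^+ k by rewrite exprn_gt0// invr_gt0.
rewrite mulrA [X in X <= _]mulrC ler_pM2r// => h.
have := ler_wpM2l (normr_ge0 b) Hk; move: h.
have : `|b| * (4 * (`|b| + 1))^-1 <= 4^-1.
  have b0 := normr_ge0 b.
  by rewrite ler_pdivrMr ?mulr_gt0 ?ltr_wpDl//; lra.
lra.
Qed.

End Operators.

(** * Finitely generated submodules and compact operators on tails *)

Section TailEstimates.
Context (R : realType) (A : cstarAlgType R) (HA : is_wstar A).
Implicit Types (x y z : nat -> A) (F G : (nat -> A) -> nat -> A) (M : set (nat -> A)).

Lemma ractDl x y a : ract (x + y) a = ract x a + ract y a.
Proof. by apply/funext => i; rewrite /ract mulrDl. Qed.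
Lemma ract0l a : ract (0 : nat -> A) a = 0.
Proof. by apply/funext => i; rewrite /ract mul0r. Qed.
Lemma ractM x a b : ract (ract x a) b = ract x (a * b).
Proof. by apply/funext => i; rewrite /ract mulrA. Qed.
Lemma ract_suml I (r : seq I) (f : I -> nat -> A) a :
  ract (\sum_(i <- r) f i) a = \sum_(i <- r) ract (f i) a.
Proof. exact: (big_morph (fun x => ract x a) (fun x y => ractDl x y a) (ract0l a)). Qed.
Lemma ractDr x a b : ract x (a + b) = ract x a + ract x b.
Proof. by apply/funext => i; rewrite /ract mulrDr. Qed.
Lemma ract0r x : ract x 0 = 0.
Proof. by apply/funext => i; rewrite /ract mulr0. Qed.
Lemma ract_sumr I (r : seq I) (f : I -> A) x :
  ract x (\sum_(i <- r) f i) = \sum_(i <- r) ract x (f i).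
Proof. exact: (big_morph (ract x) (ractDr x) (ract0r x)). Qed.
Lemma ract_scale x (c : R[i]) : ract x (c *: (1 : A)) = c *: x.
Proof. by apply/funext => i; rewrite /ract -scA_r mulr1. Qed.
Lemma ractN x a : ract (- x) a = - ract x a.
Proof. by apply/funext => i; rewrite /ract mulNr. Qed.

Lemma N2_sum I (r : seq I) (f : I -> nat -> A) : (forall i, l2 A (f i)) ->
  N2 (\sum_(i <- r) f i) <= \sum_(i <- r) N2 (f i).
Proof.
move=> lf; elim: r => [|i r IH]; first by rewrite !big_nil N20.
rewrite !big_cons; apply: (le_trans (N2D HA (lf i) _)); first exact: l2_sum.
by rewrite lerD2l.
Qed.

Lemma closed_l2 : closed_submodule (l2 A).
Proof.
split=> //; first exact: l2_0.
- by move=> c x y lx ly; apply: l2D => //; exact: l2Z.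
- by move=> x a; exact: l2_ract.
Qed.

Lemma closed_sum M I (r : seq I) (f : I -> nat -> A) :
  closed_submodule M -> (forall i, M (f i)) -> M (\sum_(i <- r) f i).
Proof.
move=> [_ M0 ML _ _] Mf; elim/big_ind: _ => // x y Mx My.
by rewrite -[x]scale1r; exact: ML.
Qed.

(** The complex coefficients of a combination can be absorbed in those of A. *)
Lemma finitely_generatedP M : closed_submodule M ->
  finitely_generated M <->
  exists (n : nat) (g : 'I_n -> nat -> A), (forall j, M (g j)) /\
    forall z, M z -> exists a : 'I_n -> A, z = \sum_(j < n) ract (g j) (a j).
Proof.
move=> cM; have [_ _ ML Mr _] := cM; split=> -[n [g [Mg H]]]; exists n, g; split=> //.
  move=> z; rewrite H => -[c [a ->]]; exists (fun j => c j *: (1 : A) + a j).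
  by apply: eq_bigr => j _; rewrite ractDr ract_scale.
apply/seteqP; split=> [z /H[a ->]|z [c [a ->]]].
  by exists (fun=> 0), a; apply: eq_bigr => j _; rewrite scale0r add0r.
by apply: closed_sum => // j; apply: ML => //; exact: Mr.
Qed.

Lemma tails_small n (g : 'I_n -> nat -> A) (e : R) : (forall j, l2 A (g j)) -> 0 < e ->
  exists N, forall m, (N <= m)%N -> \sum_(j < n) N2 (tailp m (g j)) <= e.
Proof.
move=> lg e0; have en : 0 < e / n.+1%:R by rewrite divr_gt0.
have /choice[N HN] := fun j => N2_tail_small HA (lg j) en.
exists (\max_(j < n) N j)%N => m Nm.
apply: (@le_trans _ _ (\sum_(j < n) e / n.+1%:R)).
  by apply: ler_sum => j _; apply: HN; apply: leq_trans Nm; exact: leq_bigmax.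
rewrite sumr_const card_ord -[_ *+ n]mulr_natr mulrAC ler_pdivrMr ?ltr0n//.
by rewrite ler_wpM2l ?(ltW e0)// ler_nat.
Qed.

Definition bounded_below_tail n (c : R) G : Prop :=
  0 < c /\ forall y, l2 A y -> tailp n y = y -> c * N2 y <= N2 (G y).

Definition is_adjoint F G : Prop :=
  forall x y, l2 A x -> l2 A y -> l2ip (F x) y = l2ip x (G y).

Lemma adjoint_sym F G : blop F -> blop G -> is_adjoint F G -> is_adjoint G F.
Proof.
move=> HF HG adj x y lx ly; have lG := blop_l2 HG lx; have lF := blop_l2 HF ly.
by rewrite -(l2ip_star HA ly lG) -adj// l2ip_star.
Qed.

(** If z = F x + sum_j g_j a_j, then <y, z> is bounded by a constant depending
    on z times |G y| + sum_j |<y, g_j>|; so this quantity dominates |y|, and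
    its second term is negligible on remote tails. *)
Lemma cofinite_range_bounded_below F G n (g : 'I_n -> nat -> A) :
  blop F -> blop G -> is_adjoint F G -> (forall j, l2 A (g j)) ->
  (forall z, l2 A z -> exists x (a : 'I_n -> A),
     l2 A x /\ z = F x + \sum_(j < n) ract (g j) (a j)) ->
  exists m c, bounded_below_tail m c G.
Proof.
move=> HF HG adj lg onto; have adj' := adjoint_sym HF HG adj.
pose w y := N2 (G y) + \sum_(j < n) rn (l2ip y (g j)).
have w1 y : N2 (G y) <= w y by rewrite lerDl sumr_ge0// => j _; rewrite rn_ge0.
have w2 y j : rn (l2ip y (g j)) <= w y.
  rewrite /w (bigD1 j)//= addrCA lerDl addr_ge0 ?N2_ge0// sumr_ge0// => i _.
  by rewrite rn_ge0.
have [|s y ly s0|z lz|c c0 cw] := uniform_lower_bound HA closed_l2 (w := w).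
- by move=> y _; apply: le_trans (w1 y); exact: N2_ge0.
- rewrite /w (blopZ HG)// N2Z ?rnC ?ger0_norm//; last exact: blop_l2.
  rewrite mulrDr mulr_sumr; congr (_ + _); apply: eq_bigr => j _.
  by rewrite l2ipZl// rnZ rn_conj rnC ger0_norm.
- have [x [a [lx ->]]] := onto z lz.
  exists (N2 x + \sum_(j < n) rn (a j)) => y ly.
  have lFx := blop_l2 HF lx; have lGy := blop_l2 HG ly.
  have lga j : l2 A (ract (g j) (a j)) by apply: l2_ract.
  rewrite (l2ipDr HA)//; last exact: l2_sum.
  rewrite -adj'// l2ip_sumr// (le_trans (rnD _ _))// mulrDl lerD//.
    rewrite (le_trans (l2ip_cs HA _ _))// mulrC ler_wpM2l ?N2_ge0//.
  rewrite (le_trans (rn_sum _ _ _))// mulr_suml; apply: ler_sum => j _.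
  rewrite (l2ip_ractr HA)// (le_trans (rnM _ _))// mulrC.
  by rewrite ler_wpM2l ?rn_ge0.
have [m Hm] := tails_small lg (divr_gt0 c0 (ltr0n R 2)).
exists m, (c / 2); split=> [|y ly ty]; first by rewrite divr_gt0.
have h1 := cw y ly.
have h2 : \sum_(j < n) rn (l2ip y (g j)) <= (c / 2) * N2 y.
  apply: le_trans (ler_wpM2r (N2_ge0 y) (Hm m (leqnn m))).
  rewrite mulr_suml; apply: ler_sum => j _.
  rewrite -ty l2ip_tail mulrC; apply: (le_trans (l2ip_cs HA ly _)).
    exact: l2_tail.
  by rewrite ty.
by move: h1; rewrite /w; lra.
Qed.

Lemma Fredholm_bounded_below F G :
  blop F -> blop G -> is_adjoint F G -> lower_semi_Fredholm F ->
  exists m c, bounded_below_tail m c G.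
Proof.
move=> HF HG adj [_ [M1 [N1 [M2 [P2 [[[cM1 _ _ _] [cM2 cP2 _ sum2]] _ _ iso fg]]]]]].
have [n [g [Pg Hg]]] := (finitely_generatedP cP2).1 fg.
have [P2l _ _ _ _] := cP2; have [M1l _ _ _ _] := cM1.
apply: (cofinite_range_bounded_below HF HG adj (g := g)) => [j|z]; first exact: P2l.
move=> lz; have := lz; rewrite {1}sum2 => -[m2 M2m [p2 P2p <-]].
have [_ [_ _ surj]] := iso; have [m1 M1m <-] := surj _ M2m.
have [a ->] := Hg _ P2p.
by exists m1, a; split=> //; exact: (M1l _ M1m).
Qed.

(** It suffices to treat a finite rank operator, whose range is generated by
    finitely many vectors with small tails. *)
Lemma compact_tail K (e : R) : adjointable_compact K -> 0 < e ->
  exists N, forall m, (N <= m)%N -> forall x, l2 A x -> N2 (tailp m (K x)) <= e * N2 x.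
Proof.
move=> [[HK _] Kc] e0; have e2 : 0 < e / 2 by rewrite divr_gt0.
have [|T [n [c [u [v [luv HT]]]]] KT] := Kc (e / 2)%:C; first by rewrite ltcR.
have lu j : l2 A (u j) by case: (luv j).
have lv j : l2 A (v j) by case: (luv j).
(* The vectors u_j with the constants of the finite rank operator absorbed. *)
pose g j : nat -> A := (rn (c j) * N2 (v j))%:C *: u j.
have lg j : l2 A (g j) by exact: l2Z.
have [N HN] := tails_small lg e2.
exists N => m Nm x lx.
have lT : l2 A (T x).
  by rewrite HT//; apply: l2_sum => // j _; apply: l2Z => //; exact: l2_ract.
have lK := blop_l2 HK lx.
have -> : K x = (K x - T x) + T x by rewrite subrK.
have -> : tailp m (K x - T x + T x) = tailp m (K x - T x) + tailp m (T x).
  by rewrite -[K x - T x]scale1r tailpZD !scale1r.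
have lKT : l2 A (K x - T x) by exact: l2B.
rewrite (le_trans (N2D HA (l2_tail lKT) (l2_tail lT)))//.
have h1 : N2 (tailp m (K x - T x)) <= e / 2 * N2 x.
  apply: (le_trans (N2_tail_le HA m lKT)).
  by have := KT x lx; rewrite !l2normE -rmorphM lecR.
have h2 : N2 (tailp m (T x)) <= e / 2 * N2 x.
  apply: le_trans (ler_wpM2r (N2_ge0 x) (HN m Nm)).
  have -> : tailp m (T x) = \sum_(j < n) c j *: ract (tailp m (u j)) (l2ip (v j) x).
    rewrite HT//; apply/funext => i; rewrite [in RHS]fct_sumE [LHS]/tailp; case: ifP => mi.
      rewrite fct_sumE; apply: eq_bigr => j _.
      by rewrite -[RHS]/(c j *: (tailp m (u j) i * _)) /tailp mi.
    rewrite big1// => j _.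
    by rewrite -[LHS]/(c j *: (tailp m (u j) i * _)) /tailp mi mul0r scaler0.
  have lterm j : l2 A (c j *: ract (tailp m (u j)) (l2ip (v j) x)).
    by apply: l2Z => //; apply: l2_ract => //; exact: l2_tail.
  rewrite mulr_suml (le_trans (N2_sum _ lterm))//; apply: ler_sum => j _.
  have ltu : l2 A (tailp m (u j)) by exact: l2_tail.
  have -> : tailp m (g j) = (rn (c j) * N2 (v j))%:C *: tailp m (u j).
    by rewrite /g -[_ *: u j]addr0 tailpZD tailp0 addr0.
  rewrite !(N2Z HA)//; last exact: l2_ract.
  rewrite rnC ger0_norm ?mulr_ge0 ?rn_ge0 ?N2_ge0// -!mulrA ler_wpM2l ?rn_ge0//.
  rewrite (le_trans (N2_ract HA _ ltu))// mulrCA ler_wpM2l ?N2_ge0//.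
  exact: l2ip_cs.
lra.
Qed.

(** On remote tails |L y|^2 = <K (L y), y> is at most e |L y| |y|, because the
    range of K has small tails. *)
Lemma bounded_below_tail_compact K L G n c :
  blop G -> adjointable_compact K -> blop L -> is_adjoint K L ->
  bounded_below_tail n c G ->
  exists m d, bounded_below_tail m d (fun y => G y - L y).
Proof.
move=> HG Kc HL adj [c0 Hc]; have [[HK _] _] := Kc.
have c2 : 0 < c / 2 by rewrite divr_gt0.
have [N HN] := compact_tail Kc c2.
exists (maxn n N), (c / 2); split=> // y ly ty.
have tn : tailp n y = y by apply: tailp_fix ty; rewrite leq_maxl.
have tN : tailp N y = y by apply: tailp_fix ty; rewrite leq_maxr.
have lL := blop_l2 HL ly; have lK := blop_l2 HK lL.
have LL : N2 (L y) <= c / 2 * N2 y.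
  have [->|L0] := eqVneq (N2 (L y)) 0; first by rewrite mulr_ge0 ?(ltW c2) ?N2_ge0.
  have Lp : 0 < N2 (L y) by rewrite lt_def L0 N2_ge0.
  rewrite -(ler_pM2l Lp) -expr2 N2_sq -adj// -tN -(l2ip_tail N (K _) y).
  rewrite tN (le_trans (l2ip_cs HA (l2_tail lK) ly))// mulrCA mulrA.
  rewrite ler_wpM2r ?N2_ge0//; exact: HN.
have := Hc y ly tn.
have := N2D HA (l2B HA (blop_l2 HG ly) lL) lL; rewrite subrK.
lra.
Qed.

Lemma blop_comp F G : blop F -> blop G -> blop (fun x => F (G x)).
Proof.
move=> HF HG; have [C C0 HC] := blop_bound HF; have [D D0 HD] := blop_bound HG.
apply: (@blop_of _ _ _ (C * D)) => [x lx|c x y lx ly|x a lx|x lx].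
- exact/(blop_l2 HF)/(blop_l2 HG).
- by rewrite (blopZD HG)// (blopZD HF)//; exact: blop_l2.
- by rewrite (blop_ract HG)// (blop_ract HF)//; exact: blop_l2.
- apply: (le_trans (HC _ (blop_l2 HG lx))).
  by rewrite -mulrA ler_pM2l// HD.
Qed.
Lemma blop_tail n : blop (@tailp R A n).
Proof.
apply: (@blop_of _ _ _ 1) => [x lx|c x y _ _|x a _|x lx].
- exact: l2_tail.
- exact: tailpZD.
- exact: tailp_ract.
- by rewrite mul1r N2_tail_le.
Qed.
Lemma blop_id : blop (@id (nat -> A)).
Proof. by apply: (@blop_of _ _ _ 1) => // x lx; rewrite mul1r. Qed.
Lemma blopDZ F G (t : R[i]) : blop F -> blop G -> blop (fun x => F x + t *: G x).
Proof.
move=> HF HG; have [C C0 HC] := blop_bound HF; have [D D0 HD] := blop_bound HG.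
apply: (@blop_of _ _ _ (C + rn t * D)) => [x lx|c x y lx ly|x a lx|x lx].
- by apply: l2D => //; [exact: blop_l2|apply: l2Z => //; exact: blop_l2].
- rewrite (blopZD HF)// (blopZD HG)// !scalerDr addrACA; congr (_ + _ + _).
  by rewrite !scalerA mulrC.
- rewrite (blop_ract HF)// (blop_ract HG)// ractDl; congr (_ + _).
  by apply/funext => i; rewrite -[LHS]/(t *: (G x i * a)) scA_l.
- have lF := blop_l2 HF lx; have lG := blop_l2 HG lx.
  rewrite (le_trans (N2D HA lF (l2Z HA lG)))// N2Z// mulrDl lerD ?HC//.
  by rewrite -mulrA ler_wpM2l ?rn_ge0// HD.
Qed.

(** A Neumann series: the solution is the sum of the u_k, where U u_0 = w and
    U u_(k+1) = - W u_k, and the bounds on U and W make |u_k| decrease like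
    2^-k. *)
Lemma perturbation_onto M U W (gam : R) :
  closed_submodule M -> blop U -> blop W ->
  (forall x, M x -> M (U x)) -> (forall x, M x -> M (W x)) -> 0 < gam ->
  (forall x, M x -> gam * N2 x <= N2 (U x)) ->
  (forall x, M x -> N2 (W x) <= gam / 2 * N2 x) ->
  (forall w, M w -> exists2 x, M x & U x = w) ->
  forall w, M w -> exists2 x, M x & U x + W x = w.
Proof.
move=> cM HU HW MU MW g0 Ug Wg Uonto w Mw; have [Ml M0 ML Mr _] := cM.
have MN x : M x -> M (- x) by rewrite -scaleN1r; exact: closed_submoduleZ.
have /choice[S HS] : forall y, exists x, M y -> M x /\ U x = y.
  move=> y; have [My|nMy] := pselect (M y); last by exists 0.
  by have [x] := Uonto y My; exists x.
pose u := fix u k := if k is k'.+1 then S (- W (u k')) else S w.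
pose s := fix s k := if k is k'.+1 then s k' + u k' else 0.
have sS k : s k.+1 = s k + u k by [].
have Mu k : M (u k).
  by elim: k => [|k IH] /=; [case: (HS w Mw)|case: (HS _ (MN _ (MW _ IH)))].
have Ms k : M (s k).
  by elim: k => [//|k IH] /=; rewrite addrC -[u k]scale1r; apply: ML.
have UuS k : U (u k.+1) = - W (u k) by case: (HS _ (MN _ (MW _ (Mu k)))).
have lu k := Ml _ (Mu k); have ls k := Ml _ (Ms k).
have Nu k : N2 (u k) <= N2 (u 0%N) * 2^-1 ^+ k.
  elim: k => [|k IH]; first by rewrite expr0 mulr1.
  rewrite exprS mulrCA -(ler_pM2l g0).
  apply: (le_trans (Ug _ (Mu _))); rewrite UuS N2N (le_trans (Wg _ (Mu k)))//.
  by rewrite -mulrA ler_pM2l// ler_pM2l// invr_gt0.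
have q01 : 0 <= (2^-1 : R) < 1 by lra.
have [|x lx sx] := geometric_limit HA (N2_ge0 (u 0%N)) q01 ls.
  by move=> k; rewrite /= addrAC subrr add0r.
have Mx : M x.
  apply: (closed_limit cM _ q01 lx Ms sx).
  by rewrite divr_ge0 ?N2_ge0//; lra.
exists x => //.
(* The partial sums solve the equation with W lagging by one step. *)
have inv k : U (s k.+1) + W (s k) = w.
  elim: k => [|k IH].
    by rewrite /= add0r (blop0 HW) addr0; case: (HS w Mw).
  rewrite (sS k.+1) (blopD HU)// UuS [in W (s _)]sS (blopD HW)//.
  by rewrite addrACA addNr addr0.
have [CU CU0 HCU] := blop_bound HU; have [CW CW0 HCW] := blop_bound HW.
have lUx := blop_l2 HU lx; have lWx := blop_l2 HW lx; have lw := Ml _ Mw.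
have lUW : l2 A (U x + W x - w) by apply: l2B => //; exact: l2D.
apply/subr0_eq/(N2_eq0 HA lUW)/eqP; rewrite eq_le N2_ge0 andbT.
pose D := N2 (u 0%N) / (1 - 2^-1); have D0 : 0 <= D by rewrite divr_ge0 ?N2_ge0//; lra.
apply/ler_addgt0Pr => e e0.
pose C := (CU + CW) * D + 1; have C0 : 0 < C by rewrite ltr_wpDl// mulr_ge0// addr_ge0 ?ltW.
have [k Hk] := exp_small q01 (divr_gt0 e0 C0).
have -> : U x + W x - w = U (x - s k.+1) + W (x - s k).
  by rewrite -(inv k) opprD addrACA -!blopB.
have h1 : N2 (U (x - s k.+1)) <= CU * (D * 2^-1 ^+ k).
  apply: (le_trans (HCU _ (l2B HA lx (ls _)))); rewrite ler_pM2l// N2BC.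
  apply: (le_trans (sx _)); rewrite exprS ler_wpM2l// ler_piMl// ?exprn_ge0//; lra.
have h2 : N2 (W (x - s k)) <= CW * (D * 2^-1 ^+ k).
  by apply: (le_trans (HCW _ (l2B HA lx (ls _)))); rewrite ler_pM2l// N2BC sx.
have l1 := blop_l2 HU (l2B HA lx (ls k.+1)); have l2' := blop_l2 HW (l2B HA lx (ls k)).
apply: (le_trans (N2D HA l1 l2')); rewrite add0r.
have : C * 2^-1 ^+ k <= e by rewrite mulrC -ler_pdivlMr.
have p0 : 0 <= (2^-1 : R) ^+ k by rewrite exprn_ge0//; lra.
rewrite /C; lra.
Qed.

(** A closed submodule of a Hilbert module need not be complemented, so
    surjectivity is not reached by taking the complement of the range.
    Instead T + t is onto for large t, and the set of such t is stable under
    steps of length gam / 2 because the lower bound is uniform in t. *)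
Lemma positive_onto M T (gam : R) :
  closed_submodule M -> blop T -> (forall x, M x -> M (T x)) -> 0 < gam ->
  (forall (t : R) x, 0 <= t -> M x -> gam * N2 x <= N2 (T x + t%:C *: x)) ->
  forall w, M w -> exists2 x, M x & T x = w.
Proof.
move=> cM HT MT g0 Tg; have [Ml M0 ML Mr _] := cM.
pose d := gam / 2; have d0 : 0 < d by rewrite divr_gt0.
pose U (t : R) x := T x + t%:C *: x.
have HU t : blop (U t) by apply: blopDZ => //; exact: blop_id.
have MU t x : M x -> M (U t x) by move=> Mx; rewrite /U addrC; apply: ML => //; exact: MT.
have [C C0 HC] := blop_bound HT.
(* The number of steps needed from a t at least twice the norm of T. *)
pose J := (Num.bound (2 * C / d)).+1.
have onto k : forall w, M w -> exists2 x, M x & U ((J - k)%:R * d) x = w.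
  elim: k => [|k IH] w Mw.
    rewrite subn0; set t := J%:R * d.
    have tC : 2 * C <= t.
      rewrite -ler_pdivrMr//; apply: ltW; apply: (lt_le_trans (archi_boundP _)).
        by rewrite divr_ge0 ?(ltW d0)// mulr_ge0 ?(ltW C0).
      by rewrite ler_nat leqW.
    have t0 : 0 < t by rewrite (lt_le_trans _ tC)// mulr_gt0.
    have tid : blop (fun x : nat -> A => 0 + t%:C *: x).
      apply: (@blopDZ (fun=> 0) id) blop_id.
      apply: (@blop_of _ _ _ 0) => [x _|c x y _ _|x a _|x _].
      - exact: l2_0.
      - by rewrite scaler0 addr0.
      - by rewrite ract0l.
      - by rewrite N20 mul0r.
    have [|x Mx|x Mx|v Mv|x Mx xw] := perturbation_onto cM tid HT _ MT t0 _ _ _ Mw.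
    - by move=> x Mx; rewrite add0r; exact: closed_submoduleZ.
    - by rewrite add0r N2Z// ?rnC ?gtr0_norm//; exact: Ml.
    - rewrite (le_trans (HC _ (Ml _ Mx)))// ler_wpM2r ?N2_ge0//; lra.
    - exists (t^-1%:C *: v); first exact: closed_submoduleZ.
      by rewrite add0r scalerA -rmorphM mulfV ?gt_eqF// rmorph1 scale1r.
    - by exists x => //; rewrite /U -xw add0r addrC.
  have [Jk|kJ] := leqP J k.
    have -> : (J - k.+1 = J - k)%N by move: Jk; rewrite subnS -subn_eq0 => /eqP ->.
    exact: IH.
  have -> : (J - k.+1)%:R * d = (J - k)%:R * d - d :> R.
    by rewrite -(subnSK kJ) -[in RHS]addn1 natrD; ring.
  set t := (J - k)%:R * d in IH *.
  have t0 : 0 <= t by rewrite mulr_ge0 ?ler0n ?ltW.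
  have nid : blop (fun x : nat -> A => 0 + (- d)%:C *: x).
    apply: (@blopDZ (fun=> 0) id) blop_id.
    apply: (@blop_of _ _ _ 0) => [x _|c x y _ _|x a _|x _].
    - exact: l2_0.
    - by rewrite scaler0 addr0.
    - by rewrite ract0l.
    - by rewrite N20 mul0r.
  have [x Mx|x Mx|x Mx|x Mx xw] := perturbation_onto cM (HU t) nid (MU t) _ g0 _ _ IH Mw.
  - by rewrite add0r; exact: closed_submoduleZ.
  - exact: Tg.
  - by rewrite add0r N2Z// ?rnC ?normrN ?gtr0_norm//; exact: Ml.
  - by exists x => //; rewrite /U -xw add0r rmorphB scalerBl rmorphN scaleNr addrA.
move=> w Mw; have [x Mx xw] := onto J w Mw; exists x => //.
by rewrite -xw /U subnn mul0r rmorph0 scale0r addr0.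
Qed.

End TailEstimates.

(** * Kernels and Fredholm decompositions *)

Section Fredholm.
Context (R : realType) (A : cstarAlgType R) (HA : is_wstar A).
Implicit Types (x y z : nat -> A) (F G : (nat -> A) -> nat -> A) (M : set (nat -> A)).

Lemma blop_sub F G : blop F -> blop G -> blop (fun x => F x - G x).
Proof.
move=> HF HG; have := blopDZ HA (-1) HF HG.
by under eq_fun do rewrite scaleN1r.
Qed.

Lemma closed_kernel (T : (nat -> A) -> nat -> A) : blop T ->
  closed_submodule [set x | l2 A x /\ T x = 0].
Proof.
move=> HT; split.
- by move=> x [].
- by split; [exact: l2_0|exact: blop0].
- move=> c x y [lx Tx] [ly Ty]; split; first by apply: l2D => //; exact: l2Z.
  by rewrite (blopZD HT)// Tx Ty scaler0 addr0.
- move=> x a [lx Tx]; split; first exact: l2_ract.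
  by rewrite (blop_ract HT)// Tx ract0l.
- move=> x lx H; split=> //; have [C C0 HC] := blop_bound HT.
  apply: (N2_eq0 HA (blop_l2 HT lx)); apply/eqP; rewrite eq_le N2_ge0 andbT.
  apply/ler_addgt0Pr => e e0; rewrite add0r.
  have [|y [ly Ty]] := H (e / C)%:C; first by rewrite ltcR divr_gt0.
  rewrite l2normE ltcR => xy.
  rewrite -[T x]subr0 -Ty -(blopB HA HT)// (le_trans (HC _ (l2B HA lx ly)))//.
  by rewrite mulrC -ler_pdivlMr// ltW.
Qed.

Lemma closed_fixed (T : (nat -> A) -> nat -> A) : blop T ->
  closed_submodule [set x | l2 A x /\ T x = x].
Proof.
move=> HT; suff -> : [set x | l2 A x /\ T x = x] = [set x | l2 A x /\ T x - x = 0].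
  exact: closed_kernel (blop_sub HT (@blop_id R A)).
apply/seteqP; split=> x [lx] /= h; split=> //; first by rewrite h subrr.
exact: subr0_eq.
Qed.

Lemma direct_sum_idempotent (E : (nat -> A) -> nat -> A) : blop E ->
  (forall x, l2 A x -> E (E x) = E x) ->
  direct_sum [set x | l2 A x /\ E x = x] [set x | l2 A x /\ E x = 0].
Proof.
move=> HE EE; split; [exact: closed_fixed|exact: closed_kernel| |].
  apply/seteqP; split=> [x [[_ Ex] [_ E0]]|x ->]; first by rewrite -Ex.
  by split; split; rewrite ?(blop0 HE)//; exact: l2_0.
apply/seteqP; split=> [x lx|_ [x [lx _] [y [ly _] <-]]]; last exact: l2D.
have lE := blop_l2 HE lx.
exists (E x); first by split=> //; exact: EE.
exists (x - E x); last by rewrite addrCA subrr addr0.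
by split; [exact: l2B|rewrite (blopB HA HE)// EE// subrr].
Qed.

Section TailInverse.
Context (F G : (nat -> A) -> nat -> A) (HF : blop F) (HG : blop G).
Context (adj : is_adjoint F G) (n : nat) (c : R) (bb : bounded_below_tail n c G).

(** The lower bound holds uniformly for all translates by t >= 0: the inner
    product of x with its image is <G x, G x> + t <x, x>, a sum of two positive
    elements, whose norm is at least that of the first. *)
Lemma tail_quad_ge x (t : R) : l2 A x -> tailp n x = x -> 0 <= t ->
  c ^+ 2 * N2 x <= N2 (tailp n (F (G x)) + t%:C *: x).
Proof.
move=> lx tx t0; have [c0 Hc] := bb.
have lG := blop_l2 HG lx; have lFG := blop_l2 HF lG.
have lT : l2 A (tailp n (F (G x)) + t%:C *: x).
  by apply: l2D => //; [exact: l2_tail|exact: l2Z].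
have [->|N0] := eqVneq (N2 x) 0; first by rewrite mulr0 N2_ge0.
have Np : 0 < N2 x by rewrite lt_def N0 N2_ge0.
rewrite -(ler_pM2l Np); apply: le_trans (l2ip_cs HA lx lT).
have -> : l2ip x (tailp n (F (G x)) + t%:C *: x) = l2ip (G x) (G x) + t%:C *: l2ip x x.
  rewrite (l2ipDr HA)//; [|exact: l2_tail|exact: l2Z].
  rewrite l2ipZr// -l2ip_tail tx.
  by rewrite -(adjoint_sym HA HF HG adj lx lG).
apply: le_trans (l2ip_le HA lG lx t0); rewrite -N2_sq.
have := Hc x lx tx => h.
have -> : N2 x * (c ^+ 2 * N2 x) = (c * N2 x) ^+ 2 by ring.
by rewrite ler_pXn2r ?nnegrE ?mulr_ge0 ?N2_ge0// ltW.
Qed.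

Lemma tail_onto w : l2 A w -> tailp n w = w ->
  exists r, [/\ l2 A r, tailp n r = r & tailp n (F (G r)) = w].
Proof.
move=> lw tw; have [c0 Hc] := bb.
have HT : blop (fun x => tailp n (F (G x))).
  exact: blop_comp (blop_tail HA n) (blop_comp HF HG).
have [|||x [lx tx] xw] := @positive_onto _ _ HA _ _ (c ^+ 2)
    (closed_fixed (blop_tail HA n)) HT _ _ _ w (conj lw tw).
- move=> x [lx _]; split; first exact: (blop_l2 HT lx).
  by rewrite tailpK.
- by rewrite exprn_gt0.
- by move=> t x t0 [lx tx]; exact: tail_quad_ge.
by exists x.
Qed.

(** Let b_j = e_j + s_j, where the tail s_j is chosen such that P F G b_j = 0.
    For x in Ker G the difference y of x and sum_j b_j x_j is a tail with
    P F G y = 0, hence G y = 0 and y = 0.  Thus Ker G consists of the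
    combinations of the b_j whose coefficients are relations among the
    G b_j. *)
Lemma kernel_finitely_generated :
  finitely_generated [set y | l2 A y /\ G y = 0].
Proof.
have [c0 Hc] := bb.
have HT : blop (fun x => tailp n (F (G x))).
  exact: blop_comp (blop_tail HA n) (blop_comp HF HG).
have le j : l2 A (ebasis A j) by exact: l2_ebasis.
have /choice[s Hs] : forall j : nat, exists r, [/\ l2 A r, tailp n r = r
    & tailp n (F (G (ebasis A j + r))) = 0].
  move=> j; have lT := blop_l2 HT (le j).
  have [|r [lr tr Tr]] := @tail_onto (- tailp n (F (G (ebasis A j)))) (l2N HA lT).
    by rewrite -[- tailp n _]sub0r tailpB tailp0 tailpK.
  exists r; split=> //; rewrite -/((fun x => tailp n (F (G x))) _) (blopD HT)//=.
  by rewrite Tr subrr.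
have ls j : l2 A (s j) by case: (Hs j).
pose b j := ebasis A j + s j.
have lb j : l2 A (b j) by exact: l2D.
have [a [a0 aker]] := @syzygy_finitely_generated R A HA n (fun j => G (b j))
  (fun j => blop_l2 HG (lb j)).
have Gsum (d : 'I_n -> A) : G (\sum_(j < n) ract (b j) (d j)) =
    \sum_(j < n) ract (G (b j)) (d j).
  rewrite (blop_sum HA HG) => [|j]; last exact: l2_ract.
  by apply: eq_bigr => j _; rewrite (blop_ract HG).
apply/(finitely_generatedP (closed_kernel HG)).
exists n, (fun k => \sum_(j < n) ract (b j) (a j k)); split=> [k|x [lx Gx]].
  split; first by apply: l2_sum => // j _; exact: l2_ract.
  by rewrite Gsum.
pose y := x - \sum_(j < n) ract (b j) (x j).
have lsum (d : 'I_n -> A) : l2 A (\sum_(j < n) ract (b j) (d j)).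
  by apply: l2_sum => // j _; exact: l2_ract.
have ly : l2 A y by exact: l2B.
have yE : y = tailp n x - \sum_(j < n) ract (s j) (x j).
  rewrite /y; under eq_bigr do rewrite ractDl.
  by rewrite big_split /= opprD addrA -head_sum opprB addrCA subrr addr0.
have ty : tailp n y = y.
  have HP := blop_tail HA n.
  have lss j : l2 A (ract (s j) (x j)) by exact: l2_ract.
  rewrite yE (blopB HA HP) ?tailpK// ?(blop_sum HA HP)//; [|exact: l2_tail|exact: l2_sum].
  congr (_ - _); apply: eq_bigr => j _; rewrite tailp_ract.
  by case: (Hs j) => _ ->.
have y0 : y = 0.
  have lGy := blop_l2 HG ly.
  have Ty : tailp n (F (G y)) = 0.
    rewrite -/((fun x => tailp n (F (G x))) y) /y (blopB HA HT)// (blop_sum HA HT) => [|j]; last exact: l2_ract.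
    rewrite /= Gx (blop0 HF) tailp0 sub0r big1 ?oppr0// => j _.
    rewrite (blop_ract HG)// (blop_ract HF) ?tailp_ract; last exact: blop_l2.
    by case: (Hs j) => _ _ ->; rewrite ract0l.
  apply: (N2_eq0 HA ly); apply/eqP; rewrite eq_le N2_ge0 andbT.
  have GG : N2 (G y) = 0.
    apply/eqP; rewrite -sqrf_eq0 N2_sq (adjoint_sym HA HF HG adj ly lGy).
    by rewrite -ty l2ip_tail ty Ty l2ip0r rn0.
  by have := Hc y ly ty; rewrite GG pmulr_rle0.
have xE : x = \sum_(j < n) ract (b j) (x j) by apply/subr0_eq; rewrite -/y y0.
have xj (j : 'I_n) : x j = \sum_(k < n) a j k * x k.
  by apply: (aker (fun j => x j)); rewrite -Gsum -xE.
exists (fun k => x k); rewrite {1}xE.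
under eq_bigr do rewrite xj ract_sumr.
rewrite exchange_big /=; apply: eq_bigr => k _.
rewrite ract_suml; apply: eq_bigr => j _.
by rewrite ractM.
Qed.

(** The operator S = G R P, where R inverts P F G on the tails at n. *)
Lemma tail_right_inverse : exists S, [/\ blop S,
  forall y, l2 A y -> tailp n (F (S y)) = tailp n y
  & forall y, l2 A y -> S (tailp n y) = S y].
Proof.
have [c0 Hc] := bb; have c2 : 0 < c ^+ 2 by rewrite exprn_gt0.
have HP := blop_tail HA n.
have HT : blop (fun x => tailp n (F (G x))).
  exact: blop_comp HP (blop_comp HF HG).
have /choice[r Hr] : forall w, exists r, l2 A w -> tailp n w = w ->
    [/\ l2 A r, tailp n r = r & tailp n (F (G r)) = w].
  move=> w; have [[lw tw]|nw] := pselect (l2 A w /\ tailp n w = w).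
    by have [r Hr] := tail_onto lw tw; exists r.
  by exists 0 => lw tw; case: nw.
have Hrt y : l2 A y -> [/\ l2 A (r (tailp n y)), tailp n (r (tailp n y)) = r (tailp n y)
    & tailp n (F (G (r (tailp n y)))) = tailp n y].
  by move=> ly; apply: Hr; [exact: l2_tail|rewrite tailpK].
have lr y : l2 A y -> l2 A (r (tailp n y)) by move=> /Hrt[].
have inj x y : l2 A x -> l2 A y -> tailp n x = x -> tailp n y = y ->
    tailp n (F (G x)) = tailp n (F (G y)) -> x = y.
  move=> lx ly tx ty xy; have lxy := l2B HA lx ly.
  apply/subr0_eq/(N2_eq0 HA lxy)/eqP; rewrite eq_le N2_ge0 andbT.
  have := tail_quad_ge lxy _ (lexx 0); rewrite tailpB tx ty => /(_ erefl).
  rewrite rmorph0 scale0r addr0 -/((fun x => tailp n (F (G x))) _) (blopB HA HT)//=.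
  by rewrite xy subrr N20 pmulr_rle0.
have Hrn : blop (fun y => r (tailp n y)).
  apply: (@blop_of _ _ _ (c ^+ 2)^-1) => [y ly|d x y lx ly|y a ly|y ly].
  - exact: lr.
  - have [l1 t1 T1] := Hrt _ lx; have [l2' t2 T2] := Hrt _ ly.
    have lxy : l2 A (d *: x + y) by apply: l2D => //; exact: l2Z.
    have [l3 t3 T3] := Hrt _ lxy.
    apply: inj => //; first by apply: l2D => //; exact: l2Z.
      by rewrite tailpZD t1 t2.
    rewrite T3 -/((fun x => tailp n (F (G x))) (_ + _)) (blopZD HT)//= T1 T2.
    exact: tailpZD.
  - have [l1 t1 T1] := Hrt _ ly; have lya : l2 A (ract y a) by exact: l2_ract.
    have [l3 t3 T3] := Hrt _ lya.
    apply: inj => //; first exact: l2_ract.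
      by rewrite tailp_ract t1.
    rewrite T3 -/((fun x => tailp n (F (G x))) (ract _ _)) (blop_ract HT)//= T1.
    exact: tailp_ract.
  - have [l1 t1 T1] := Hrt _ ly.
    rewrite ler_pdivlMl//; apply: (le_trans (tail_quad_ge l1 t1 (lexx 0))).
    by rewrite rmorph0 scale0r addr0 T1 N2_tail_le.
exists (fun y => G (r (tailp n y))); split=> [|y /Hrt[]//|y ly].
- exact: blop_comp HG Hrn.
- by rewrite tailpK.
Qed.

(** With the right inverse S of P F, the operators S F and F S are idempotent;
    F identifies their ranges, and the kernel of F S is the module of sequences
    supported in the first n coordinates. *)
Lemma bounded_below_Fredholm : adjointable F -> lower_semi_Fredholm F.
Proof.
move=> aF; split=> //; have [S [HS FS SP]] := tail_right_inverse.
have HP := blop_tail HA n.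
have SFS y : l2 A y -> S (F (S y)) = S y.
  by move=> ly; rewrite -SP ?FS ?SP//; exact/(blop_l2 HF)/(blop_l2 HS).
have ds1 := direct_sum_idempotent (blop_comp HS HF)
  (fun x lx => SFS _ (blop_l2 HF lx)).
have ds2 := direct_sum_idempotent (blop_comp HF HS)
  (fun y ly => congr1 F (SFS y ly)).
have N2E : [set y | l2 A y /\ F (S y) = 0] = [set y | l2 A y /\ tailp n y = 0].
  apply/seteqP; split=> y [ly /= h]; split=> //.
    by rewrite -FS// h tailp0.
  by rewrite -SP// h (blop0 HS) (blop0 HF).
exists [set x | l2 A x /\ S (F x) = x], [set x | l2 A x /\ S (F x) = 0],
  [set y | l2 A y /\ F (S y) = y], [set y | l2 A y /\ F (S y) = 0].
have F12 x : l2 A x -> S (F x) = x -> l2 A (F x) /\ F (S (F x)) = F x.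
  by move=> lx SFx; split; [exact: (blop_l2 HF)|rewrite SFx].
split=> //.
- by move=> _ [x [lx SFx] <-]; exact: F12.
- move=> _ [x [lx SFx] <-]; split; first exact: (blop_l2 HF).
  by rewrite SFx (blop0 HF).
- split; first split.
  + by move=> x [lx SFx]; exact: F12.
  + by move=> d x y [lx _] [ly _]; exact: (blopZD HF).
  + by move=> x a [lx _]; exact: (blop_ract HF).
  + by have [_ _ _ [C HC]] := HF; exists C => x [lx _]; exact: HC.
  + split.
    * by move=> x [lx SFx]; exact: F12.
    * move=> x y; rewrite !inE => -[lx SFx] [ly SFy] xy.
      by rewrite -SFx -SFy xy.
    * move=> y [ly FSy]; exists (S y) => //; split; first exact: (blop_l2 HS).
      by rewrite FSy.
- rewrite N2E; apply/(finitely_generatedP (closed_kernel HP)).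
  exists n, (fun j : 'I_n => ebasis A j); split=> [j|y [ly ty]].
    by split; [exact: l2_ebasis|exact: tailp_ebasis].
  by exists (fun j : 'I_n => y j); rewrite -head_sum ty subr0.
Qed.

End TailInverse.

(** For y in M the quantity sum_j |<y, g_j>| dominates |y|, as all elements of M
    are combinations of the g_j; but for a remote tail y it is small. *)
Lemma finitely_generated_tail M : closed_submodule M -> finitely_generated M ->
  exists n, forall y, M y -> tailp n y = y -> y = 0.
Proof.
move=> cM /(finitely_generatedP cM)[n [g [Mg gen]]]; have [Ml _ _ _ _] := cM.
have lg j : l2 A (g j) := Ml _ (Mg j).
pose w y := \sum_(j < n) rn (l2ip y (g j)).
have [y _|s y My s0|z Mz|c c0 cw] := uniform_lower_bound HA cM (w := w).
- by apply: sumr_ge0 => j _; rewrite rn_ge0.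
- rewrite /w mulr_sumr; apply: eq_bigr => j _; have ly := Ml _ My.
  by rewrite l2ipZl// rnZ rn_conj rnC ger0_norm.
- have [a ->] := gen z Mz; exists (\sum_(j < n) rn (a j)) => y My.
  have ly := Ml _ My.
  rewrite l2ip_sumr// => [|j]; last exact: l2_ract.
  rewrite (le_trans (rn_sum _ _ _))// mulr_suml; apply: ler_sum => j _.
  rewrite (l2ip_ractr HA)// (le_trans (rnM _ _))// mulrC ler_wpM2l ?rn_ge0//.
  by rewrite /w (bigD1 j)//= lerDl sumr_ge0// => i _; rewrite rn_ge0.
have [m Hm] := tails_small HA lg (divr_gt0 c0 (ltr0n R 2)).
exists m => y My ty; have ly := Ml _ My.
apply: (N2_eq0 HA ly); apply/eqP; rewrite eq_le N2_ge0 andbT leNgt; apply/negP => Np.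
have h1 := cw y My.
have h2 : w y <= (c / 2) * N2 y.
  apply: le_trans (ler_wpM2r (N2_ge0 y) (Hm m (leqnn m))).
  rewrite mulr_suml; apply: ler_sum => j _.
  rewrite -ty l2ip_tail mulrC; apply: (le_trans (l2ip_cs HA ly _)).
    exact: l2_tail.
  by rewrite ty.
have := le_trans h1 h2; rewrite ler_pM2r// => ?; lra.
Qed.

End Fredholm.

(** * A compact perturbation with a large kernel *)

Section Series.
Context (R : realType) (A : cstarAlgType R) (HA : is_wstar A).
Implicit Types (x y z : nat -> A) (F G : (nat -> A) -> nat -> A).

Definition rank_sum (p v : nat -> nat -> A) n x : nat -> A :=
  \sum_(k < n) rank_one (p k) (v k) x.

Lemma rank_sumS p v n x : rank_sum p v n.+1 x = rank_sum p v n x + rank_one (p n) (v n) x.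
Proof. exact: big_ord_recr. Qed.

Lemma rank_one_le p v x : l2 A p -> l2 A v -> l2 A x ->
  N2 (rank_one p v x) <= N2 p * N2 v * N2 x.
Proof.
move=> lp lv lx; rewrite (le_trans (N2_ract HA _ lp))// -mulrA.
by rewrite ler_wpM2l ?N2_ge0//; exact: l2ip_cs.
Qed.

Lemma rank_sum_l2 p v n x : (forall k, l2 A (p k)) -> l2 A (rank_sum p v n x).
Proof. by move=> lp; apply: l2_sum => // k _; exact: l2_ract. Qed.

Arguments rank_sum_l2 p v n x _ : clear implicits.

Lemma rank_sum_ZD p v n (c : R[i]) x y : (forall k, l2 A (v k)) -> l2 A x -> l2 A y ->
  rank_sum p v n (c *: x + y) = c *: rank_sum p v n x + rank_sum p v n y.
Proof.
move=> lv lx ly; rewrite /rank_sum scaler_sumr -big_split /=; apply: eq_bigr => k _.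
rewrite /rank_one l2ipDr//; last exact: l2Z.
rewrite l2ipZr// ractDr; congr (_ + _).
by apply/funext => i; rewrite -[RHS]/(c *: (p k i * _)) scA_r.
Qed.

Lemma rank_sum_ract p v n x a : (forall k, l2 A (v k)) -> l2 A x ->
  rank_sum p v n (ract x a) = ract (rank_sum p v n x) a.
Proof.
move=> lv lx; rewrite /rank_sum ract_suml; apply: eq_bigr => k _.
by rewrite /rank_one l2ip_ractr// ractM.
Qed.

Lemma rank_sum_adjoint p v n x y : (forall k, l2 A (p k)) -> (forall k, l2 A (v k)) ->
  l2 A x -> l2 A y -> l2ip (rank_sum p v n x) y = l2ip x (rank_sum v p n y).
Proof.
move=> lp lv lx ly; have lpx k : l2 A (rank_one (p k) (v k) x) by exact: l2_ract.
have lvy k : l2 A (rank_one (v k) (p k) y) by exact: l2_ract.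
rewrite -(l2ip_star HA ly (rank_sum_l2 _ _ _ _ lp)) /rank_sum !l2ip_sumr//.
rewrite star_sum; apply: eq_bigr => k _.
rewrite l2ip_star// /rank_one l2ip_ractl// l2ip_ractr//.
by rewrite l2ip_star.
Qed.

Lemma small_eq0 x (D : R) : l2 A x -> 0 <= D ->
  (forall n, N2 x <= D * 2^-1 ^+ n) -> x = 0.
Proof.
move=> lx D0 H; apply: (N2_eq0 HA lx); apply/eqP; rewrite eq_le N2_ge0 andbT.
apply/ler_addgt0Pr => e e0; rewrite add0r.
have D1 : 0 < D + 1 by rewrite ltr_wpDl.
have q01 : 0 <= (2^-1 : R) < 1 by lra.
have [k Hk] := exp_small q01 (divr_gt0 e0 D1).
apply: (le_trans (H k)); apply: (@le_trans _ _ ((D + 1) * 2^-1 ^+ k)).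
  by rewrite ler_wpM2r ?lerDl// exprn_ge0//; lra.
by rewrite mulrC -ler_pdivlMr.
Qed.

(** The linearity of the sum is inherited from the partial sums: the defect is
    smaller than every D / 2^n. *)
Lemma rank_series (p v : nat -> nat -> A) (C : R) : 0 <= C ->
  (forall k, l2 A (p k)) -> (forall k, l2 A (v k)) ->
  (forall k, N2 (p k) * N2 (v k) <= C * 2^-1 ^+ k) ->
  exists2 L, blop L & forall x, l2 A x -> forall n,
    N2 (rank_sum p v n x - L x) <= 2 * C * 2^-1 ^+ n * N2 x.
Proof.
move=> C0 lp lv pv; have lr n x := rank_sum_l2 p v n x lp.
have q01 : 0 <= (2^-1 : R) < 1 by lra.
have /choice[L HL] : forall x, exists y, l2 A x -> l2 A y /\ forall n,
    N2 (rank_sum p v n x - y) <= 2 * C * 2^-1 ^+ n * N2 x.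
  move=> x; have [lx|nx] := pselect (l2 A x); last by exists 0.
  have [||y ly Hy] := geometric_limit HA (C := C * N2 x) _ q01 (fun n => lr n x).
  - by rewrite mulr_ge0// N2_ge0.
  - move=> k; rewrite rank_sumS addrAC subrr add0r (le_trans (rank_one_le _ _ _))//.
    by rewrite [leRHS]mulrAC ler_wpM2r ?N2_ge0.
  exists y => _; split=> // n; apply: (le_trans (Hy n)).
  have -> : C * N2 x / (1 - 2^-1) = 2 * C * N2 x by field.
  by rewrite mulrAC.
have lL x : l2 A x -> l2 A (L x) by move=> /HL[].
exists L; last by move=> x /HL[].
apply: (@blop_of _ _ _ (2 * C)) => [//|c x y lx ly|x a lx|x lx].
- have lxy : l2 A (c *: x + y) by apply: l2D => //; exact: l2Z.
  apply/subr0_eq; pose D := 2 * C * (N2 (c *: x + y) + rn c * N2 x + N2 y).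
  have D0 : 0 <= D by rewrite mulr_ge0// ?addr_ge0 ?mulr_ge0 ?rn_ge0 ?N2_ge0.
  have lcL : l2 A (c *: L x + L y).
    by apply: l2D; [|apply: l2Z => //; exact: lL|exact: lL].
  apply: (small_eq0 (D := D)) => [|//|n]; first by apply: l2B => //; exact: lL.
  have := (HL _ lxy).2 n; have := (HL _ lx).2 n; have := (HL _ ly).2 n.
  set s := rank_sum p v n => hy hx hxy.
  have -> : L (c *: x + y) - (c *: L x + L y) =
    - (s (c *: x + y) - L (c *: x + y)) + (c *: (s x - L x) + (s y - L y)).
    rewrite scalerBr addrACA -opprD -rank_sum_ZD// opprB -/s.
    by rewrite addrA subrK.
  have l1 : l2 A (s (c *: x + y) - L (c *: x + y)) by apply: l2B => //; [exact: lr|exact: lL].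
  have l2' : l2 A (s x - L x) by apply: l2B => //; [exact: lr|exact: lL].
  have l3 : l2 A (s y - L y) by apply: l2B => //; [exact: lr|exact: lL].
  have l4 := l2Z HA (c := c) l2'.
  rewrite (le_trans (N2D HA (l2N HA l1) (l2D HA l4 l3)))// N2N.
  have h4 := N2D HA l4 l3; rewrite N2Z// in h4.
  have h5 := ler_wpM2l (rn_ge0 c) hx.
  rewrite /D; lra.
- have lxa : l2 A (ract x a) by exact: l2_ract.
  apply/subr0_eq; pose D := 2 * C * (N2 (ract x a) + N2 x * rn a).
  have D0 : 0 <= D by rewrite mulr_ge0// ?addr_ge0 ?mulr_ge0 ?rn_ge0 ?N2_ge0.
  have lLa : l2 A (ract (L x) a) by apply: l2_ract => //; exact: lL.
  apply: (small_eq0 (D := D)) => [|//|n]; first by apply: l2B => //; exact: lL.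
  have := (HL _ lxa).2 n; have := (HL _ lx).2 n.
  set s := rank_sum p v n => hx hxa.
  have -> : L (ract x a) - ract (L x) a =
    - (s (ract x a) - L (ract x a)) + ract (s x - L x) a.
    rewrite ractDl ractN /s rank_sum_ract// opprB.
    by rewrite addrA subrK.
  have l1 : l2 A (s (ract x a) - L (ract x a)) by apply: l2B => //; [exact: lr|exact: lL].
  have l2' : l2 A (s x - L x) by apply: l2B => //; [exact: lr|exact: lL].
  rewrite (le_trans (N2D HA (l2N HA l1) (l2_ract HA l2')))// N2N.
  have h4 := N2_ract HA a l2'.
  have h5 := ler_wpM2r (rn_ge0 a) hx.
  rewrite /D; lra.
- have [_ /(_ 0%N)] := HL _ lx.
  by rewrite /rank_sum big_ord0 sub0r N2N expr0 mulr1.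
Qed.

Lemma rank_series_compact (p v : nat -> nat -> A) (C : R) : 0 <= C ->
  (forall k, l2 A (p k)) -> (forall k, l2 A (v k)) ->
  (forall k, N2 (p k) * N2 (v k) <= C * 2^-1 ^+ k) ->
  exists K L, [/\ adjointable_compact K, blop L, is_adjoint K L
    & forall x, l2 A x -> forall n,
    N2 (rank_sum p v n x - L x) <= 2 * C * 2^-1 ^+ n * N2 x].
Proof.
move=> C0 lp lv pv; have [L HL HpL] := rank_series C0 lp lv pv.
have [|K HK HpK] := rank_series C0 lv lp; first by move=> k; rewrite mulrC.
have q0 n : 0 <= (2^-1 : R) ^+ n by rewrite exprn_ge0//; lra.
have adj : is_adjoint K L.
  move=> x y lx ly; apply/subr0_eq/rn_eq0/eqP; rewrite eq_le rn_ge0 andbT.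
  pose D := 4 * C * N2 x * N2 y.
  have D0 : 0 <= D by rewrite !mulr_ge0 ?N2_ge0.
  apply/ler_addgt0Pr => e e0; rewrite add0r.
  have D1 : 0 < D + 1 by rewrite ltr_wpDl.
  have q01 : 0 <= (2^-1 : R) < 1 by lra.
  have [n Hn] := exp_small q01 (divr_gt0 e0 D1).
  have lsK := rank_sum_l2 v p n x lv; have lsL := rank_sum_l2 p v n y lp.
  have lK := blop_l2 HK lx; have lL := blop_l2 HL ly.
  have l1 := l2B HA lsK lK; have l2' := l2B HA lsL lL.
  have -> : l2ip (K x) y - l2ip x (L y) =
    - l2ip (rank_sum v p n x - K x) y + l2ip x (rank_sum p v n y - L y).
    rewrite (l2ipBl HA)// (l2ipBr HA)// rank_sum_adjoint// opprB.
    by rewrite addrA subrK.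
  rewrite (le_trans (rnD _ _))// rnN.
  have h1 := le_trans (l2ip_cs HA l1 ly) (ler_wpM2r (N2_ge0 y) (HpK x lx n)).
  have h2 := le_trans (l2ip_cs HA lx l2') (ler_wpM2l (N2_ge0 x) (HpL y ly n)).
  have : (D + 1) * 2^-1 ^+ n <= e by rewrite mulrC -ler_pdivlMr.
  have := q0 n; rewrite /D; lra.
exists K, L; split=> //; split; first by split=> //; exists L.
move=> e e0.
have eE : e = (complex.Re e)%:C by rewrite RRe_real ?gtr0_real.
have e0' : 0 < complex.Re e by rewrite -ltcR -eE.
have D1 : 0 < 2 * C + 1 by rewrite ltr_wpDl// mulr_ge0.
have q01 : 0 <= (2^-1 : R) < 1 by lra.
have [n Hn] := exp_small q01 (divr_gt0 e0' D1).
exists (rank_sum v p n).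
  exists n, (fun=> 1), (fun k : 'I_n => v k), (fun k : 'I_n => p k); split=> // z lz.
  by apply: eq_bigr => k _; rewrite scale1r.
move=> x lx; rewrite !l2normE eE -rmorphM lecR N2BC.
apply: (le_trans (HpK x lx n)); apply: ler_wpM2r; first exact: N2_ge0.
have : (2 * C + 1) * 2^-1 ^+ n <= complex.Re e by rewrite mulrC -ler_pdivlMr.
have := q0 n; lra.
Qed.

(** A tail y with |G y| small compared to |y| is truncated and normalized to the
    unit vector v.  Its square <v, v> is a finite sum, to which the spectral
    cutoff applies. *)
Lemma almost_kernel_block G n (e : R) : blop G ->
  ~ (exists c, bounded_below_tail n c G) -> 0 < e ->
  exists (m : nat) (v : nat -> A) (c h : A), [/\ (n < m)%N, l2 A v /\ N2 v = 1, tailp n v = v /\ tailp m v = 0,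
    N2 (G v) <= e & [/\ rn c <= 2, h <> 0 & c * l2ip v v * h = h]].
Proof.
move=> HG nbb e0; have [C C0 HC] := blop_bound HG.
have e4 : 0 < e / 4 by rewrite divr_gt0.
have [y [ly ty Gy]] : exists y, [/\ l2 A y, tailp n y = y & N2 (G y) < e / 4 * N2 y].
  apply: contrapT => H; apply: nbb; exists (e / 4); split=> // y ly ty.
  by rewrite leNgt; apply/negP => h; apply: H; exists y.
have Np : 0 < N2 y.
  rewrite lt_def N2_ge0 andbT; apply/eqP => N0; move: Gy.
  by rewrite N0 mulr0 ltNge N2_ge0.
(* A truncation error eta with 2 eta <= |y| and C eta <= e |y| / 4. *)
pose eta := N2 y * (2 + 4 * C / e)^-1.
have den : 0 < 2 + 4 * C / e by rewrite ltr_wpDr// divr_ge0 ?mulr_ge0 ?ltW.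
have eta0 : 0 < eta by rewrite mulr_gt0// invr_gt0.
have eta1 : eta * 2 <= N2 y.
  rewrite /eta mulrAC ler_pdivrMr// ler_pM2l// lerDl divr_ge0 ?mulr_ge0 ?ltW//.
have eta2 : C * eta <= e / 4 * N2 y.
  rewrite /eta mulrCA [leRHS]mulrC ler_pM2l// ler_pdivrMr//.
  have -> : e / 4 * (2 + 4 * C / e) = e / 2 + C by field; rewrite gt_eqF.
  by rewrite lerDr divr_ge0 ?ltW.
have [M HM] := N2_tail_small HA ly eta0.
pose m := maxn M n.+1; have nm : (n < m)%N by rewrite leq_maxr.
have tm := HM m (leq_maxl _ _).
have ltm : l2 A (tailp m y) by exact: l2_tail.
pose v0 := y - tailp m y; have lv0 : l2 A v0 by exact: l2B.
have Nv0 : N2 y / 2 <= N2 v0.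
  have := N2D HA lv0 ltm; rewrite subrK; lra.
have Nv0p : 0 < N2 v0 by apply: lt_le_trans Nv0; rewrite divr_gt0.
have GNv0 : N2 (G v0) <= e * N2 v0.
  rewrite (blopB HA HG)//.
  have := N2B HA (blop_l2 HG ly) (blop_l2 HG ltm); have := HC _ ltm.
  have := ler_wpM2l (ltW C0) tm; have := ler_wpM2l (ltW e0) Nv0; lra.
pose v := (N2 v0)^-1%:C *: v0; have lv : l2 A v by exact: l2Z.
have Nv : N2 v = 1.
  by rewrite N2Z// rnC ger0_norm ?invr_ge0 ?N2_ge0// mulVf// gt_eqF.
have tmv0 : tailp m v0 = 0 by rewrite tailpB tailpK// subrr.
have tZ k x (d : R[i]) : tailp k (d *: x) = d *: tailp k x.
  by rewrite -[d *: x]addr0 tailpZD tailp0 addr0.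
have tmv : tailp m v = 0 by rewrite tZ tmv0 scaler0.
have tnv : tailp n v = v by rewrite tZ tailpB ty tailpK// ltnW.
have vv : l2ip v v = psum v v m.
  have -> : psum v v m = \sum_(0 <= i < m) star (v i) * v i by [].
  have v0E i : (m <= i)%N -> v i = 0.
    by move=> mi; have := congr1 (fun f => f i) tmv; rewrite /tailp mi.
  apply: l2ip_of_tends => d d0; exists m => k mk.
  rewrite psum_sub// big_nat big1 ?rn0 ?(ltW d0)// => i /andP[/v0E -> _].
  by rewrite mulr0.
have := N2_sq v; rewrite Nv expr1n => /esym vv1.
rewrite vv in vv1; have [c [h [c2 h0 ch]]] := gram_cutoff HA vv1.
exists m, v, c, h; split=> //; last by split=> //; rewrite vv.
rewrite (blopZ HG)// N2Z ?rnC ?ger0_norm ?invr_ge0 ?N2_ge0//; last exact: blop_l2.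
by rewrite ler_pdivrMl// mulrC.
Qed.

(** The vectors v_k are taken in consecutive blocks [N_k, N_(k+1)[, so that they
    are orthogonal.  With z_k = v_k h_k only the k-th term of
    L z_k = sum_j G(v_j c_j) <v_j, z_k> survives, and it is
    G(v_k c_k <v_k, v_k> h_k) = G z_k. *)
Lemma compact_infinite_kernel G : blop G ->
  ~ (exists n c, bounded_below_tail n c G) ->
  exists K L, [/\ adjointable_compact K, blop L, is_adjoint K L
    & forall n, exists z, [/\ l2 A z, G z - L z = 0, tailp n z = z & z <> 0]].
Proof.
move=> HG nbb.
have q0 k : 0 < (2^-1 : R) ^+ k by rewrite exprn_gt0// invr_gt0.
have /choice[b Hb] : forall nk : nat * nat, exists b : nat * (nat -> A) * (A * A),
   [/\ (nk.1 < b.1.1)%N, l2 A b.1.2 /\ N2 b.1.2 = 1,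
     tailp nk.1 b.1.2 = b.1.2 /\ tailp b.1.1 b.1.2 = 0,
     N2 (G b.1.2) <= 2^-1 ^+ nk.2
    & [/\ rn b.2.1 <= 2, b.2.2 <> 0 & b.2.1 * l2ip b.1.2 b.1.2 * b.2.2 = b.2.2]].
  move=> [n k] /=; have [|m [v [c [h H]]]] := almost_kernel_block HG (n := n) _ (q0 k).
    by move=> [c Hc]; apply: nbb; exists n, c.
  by exists (m, v, (c, h)).
pose N := fix N k := if k is k'.+1 then (b (N k', k')).1.1 else 0%N.
pose B k := b (N k, k); pose v k := (B k).1.2; pose c k := (B k).2.1; pose h k := (B k).2.2.
have HB k : [/\ (N k < N k.+1)%N, l2 A (v k) /\ N2 (v k) = 1,
     tailp (N k) (v k) = v k /\ tailp (N k.+1) (v k) = 0,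
     N2 (G (v k)) <= 2^-1 ^+ k
    & [/\ rn (c k) <= 2, h k <> 0 & c k * l2ip (v k) (v k) * h k = h k]] by exact: Hb (N k, k).
have Nmono : {homo N : i j / (i <= j)%N}.
  apply: homo_leq => [//|i j k|k]; first exact: leq_trans.
  by have [/ltnW] := HB k.
have Nge k : (k <= N k)%N.
  by elim: k => // k IH; apply: leq_ltn_trans IH _; case: (HB k).
have lv k : l2 A (v k) by case: (HB k) => _ [].
pose p k := ract (G (v k)) (c k).
have lGv k : l2 A (G (v k)) by exact: (blop_l2 HG).
have lp k : l2 A (p k) by exact: l2_ract.
have pv k : N2 (p k) * N2 (v k) <= 2 * 2^-1 ^+ k.
  have [_ [_ ->] _ Gv [c2 _ _]] := HB k; rewrite mulr1 mulrC.
  by rewrite (le_trans (N2_ract HA _ (lGv k)))// mulrC [leRHS]mulrC ler_pM ?rn_ge0 ?N2_ge0.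
have [K [L [Kc HL adj HpL]]] := rank_series_compact (ler0n _ 2) lp lv pv.
exists K, L; split=> // n.
pose z := ract (v n) (h n); exists z.
have lz : l2 A z by exact: l2_ract.
have [_ _ [tv _] _ [_ h0 ch]] := HB n.
have orth k : k != n -> l2ip (v k) z = 0.
  move=> kn; rewrite /z (l2ip_ractr HA)//.
  suff -> : l2ip (v k) (v n) = 0 by rewrite mul0r.
  have far i j : (i < j)%N -> l2ip (v i) (v j) = 0.
    move=> ij; have [_ _ [tj _] _ _] := HB j; have [_ _ [_ ti] _ _] := HB i.
    by rewrite -tj -l2ip_tail -(tailpK' (v i) (Nmono _ _ ij)) ti tailp0 l2ip0l.
  have [kln|nk|/eqP] := ltngtP k n; last by rewrite (negbTE kn).
    exact: far.
  by rewrite -(l2ip_star HA)// far// star0.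
have diag : rank_one (p n) (v n) z = G z.
  rewrite /rank_one /p /z (l2ip_ractr HA)// ractM mulrA ch.
  by rewrite (blop_ract HG).
have sumE m : (n < m)%N -> rank_sum p v m z = G z.
  move=> nm; rewrite /rank_sum (bigD1 (Ordinal nm))//= diag big1 ?addr0// => k.
  move=> kn; rewrite /rank_one orth ?ract0r//.
have lGz := blop_l2 HG lz; have lLz := blop_l2 HL lz.
split=> //.
- pose D := 2 * 2 * N2 z; have D0 : 0 <= D by rewrite mulr_ge0 ?N2_ge0.
  apply: (small_eq0 (D := D)) => //; first exact: l2B.
  move=> m; rewrite -(sumE (maxn m n.+1)) ?leq_maxr//.
  apply: (le_trans (HpL z lz _)); rewrite /D mulrAC ler_wpM2l//.
  by apply: ler_wiXn2l; rewrite ?leq_maxl//; lra.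
- by rewrite tailp_ract (tailp_fix (Nge n) tv).
- move=> z0; apply: h0; rewrite -ch -mulrA -(l2ip_ractr HA)// -/z z0.
  by rewrite l2ip0r mulr0.
Qed.

Lemma orthogonal_range F K G L : blop F -> blop K -> blop G -> blop L ->
  is_adjoint F G -> is_adjoint K L ->
  orthogonal_complement [set F x - K x | x in l2 A] = [set y | l2 A y /\ G y - L y = 0].
Proof.
move=> HF HK HG HL aFG aKL; apply/seteqP; split=> y [ly H]; split=> //.
  have lz : l2 A (G y - L y) by apply: l2B => //; exact: blop_l2.
  apply: (N2_eq0 HA lz); apply/eqP; rewrite -sqrf_eq0 N2_sq.
  rewrite (l2ipBr HA)//; [|exact: blop_l2|exact: blop_l2].
  rewrite -aFG// -aKL// -(l2ipBl HA)//; [|exact: blop_l2|exact: blop_l2].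
  by rewrite H ?rn0//; exists (G y - L y).
move=> _ [x lx <-]; rewrite (l2ipBl HA)//; [|exact: blop_l2|exact: blop_l2].
rewrite aFG// aKL// -(l2ipBr HA)//; [|exact: blop_l2|exact: blop_l2].
by rewrite H l2ip0r.
Qed.

End Series.

(** * The characterization *)

Theorem corollary3p6 (R : realType) (A : cstarAlgType R) (HA : is_wstar A)
    (F : (nat -> A) -> (nat -> A)) (HF : adjointable F) :
  lower_semi_Fredholm F <->
  (forall K : (nat -> A) -> (nat -> A), adjointable_compact K ->
     finitely_generated
       (orthogonal_complement [set F x - K x | x in l2 A])).
Proof.
have [bF [G [bG aFG]]] := HF; split=> [fredF K Kc|fgK].
  have [[bK [L [bL aKL]]] _] := Kc.
  rewrite (orthogonal_range HA bF bK bG bL aFG aKL).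
  have [n [c bb]] := Fredholm_bounded_below HA bF bG aFG fredF.
  have [m [d bb']] := bounded_below_tail_compact HA bG Kc bL aKL bb.
  apply: (kernel_finitely_generated HA (blop_sub HA bF bK) (blop_sub HA bG bL) _ bb').
  move=> x y lx ly.
  rewrite (l2ipBl HA) ?(l2ipBr HA) ?aFG ?aKL//; exact: blop_l2.
have [[n [c bb]]|nbb] := pselect (exists n c, bounded_below_tail n c G).
  exact: (bounded_below_Fredholm HA bF bG aFG bb).
have [K [L [Kc bL aKL ker]]] := compact_infinite_kernel HA bG nbb.
have [[bK _] _] := Kc.
have := fgK K Kc; rewrite (orthogonal_range HA bF bK bG bL aFG aKL) => fgker.
have [n Hn] := finitely_generated_tail HA (closed_kernel HA (blop_sub HA bG bL)) fgker.
by have [z [lz Gz tz nz]] := ker n; case: nz; exact: Hn.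
Qed.
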